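(* Let $H=H_0+H_{imp}$ be a quantum impurity model with impurity size $m$. For $\tau\ge0$ let $Q_\tau$ be the orthogonal projector onto the subspace spanned by eigenvectors of $H_0$ with eigenvalue at most $\tau$. Let $\psi$ be any normalized ground state of $H$. Then $$\|(I-Q_\tau)\psi\|\le 2\exp\!\left[-\frac{\tau}{4}\log\!\left(\frac{\tau}{8em}\right)\right]$$ for all $\tau\ge 8em$, where $e=\exp(1)$.
   Context: Let $\mathcal{H}_n$ be the Fock space of $n$ fermionic modes with operators $a_j^\dagger,a_j$. Majorana operators: $c_{2j-1}=a_j+a_j^\dagger$, $c_{2j}=-i(a_j-a_j^\dagger)$, satisfying $c_pc_q+c_qc_p=2\delta_{pq}I$. A quantum impurity model is $H=H_0+H_{imp}$ with $H_0=\frac{\|h\|_1}{4}I+\frac{i}{4}\sum_{p,q=1}^{2n}h_{pq}c_pc_q$, $h$ a real antisymmetric $2n\times2n$ matrix with operator norm $\|h\|\le1$ ($\|h\|_1$ is the trace norm), and $H_{imp}=\sum_{x\in\{0,1\}^m,|x|\text{ even}}g_xc_1^{x_1}\cdots c_m^{x_m}$ an arbitrary Hermitian operator of this form ($m$ = impurity size). *)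

(* Defs.v *)
From HB Require Import structures.
From mathcomp Require Import all_boot all_order all_algebra.
From mathcomp Require Import complex.
From mathcomp Require Import all_classical all_reals sequences exp.
Set Implicit Arguments. Unset Strict Implicit. Unset Printing Implicit Defensive.
Import Order.TTheory GRing.Theory Num.Theory.
Local Open Scope ring_scope.
Local Open Scope complex_scope.

Section Defs.
Variable R : realType.
Local Notation C := R[i].

Definition mxadj (N : nat) (A : 'M[C]_N) : 'M[C]_N :=
  \matrix_(i, j) conjc (A j i).

Definition is_hermitian (N : nat) (A : 'M[C]_N) : Prop := mxadj A = A.

Definition vnorm (N : nat) (v : 'cV[C]_N) : R :=
  Num.sqrt (\sum_(i < N) ((complex.Re (v i 0)) ^+ 2 + (complex.Im (v i 0)) ^+ 2)).

Definition low_eigvec (N : nat) (A : 'M[C]_N) (tau : R) (v : 'cV[C]_N) : Prop :=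
  exists lam : R, lam <= tau /\ A *m v = lam%:C *: v.

Definition in_low_span (N : nat) (A : 'M[C]_N) (tau : R) (v : 'cV[C]_N) : Prop :=
  exists (k : nat) (w : 'I_k -> 'cV[C]_N),
    (forall i, low_eigvec A tau (w i)) /\ v = \sum_(i < k) w i.

Definition low_projector (N : nat) (A : 'M[C]_N) (tau : R) (Q : 'M[C]_N) : Prop :=
  [/\ is_hermitian Q, Q *m Q = Q &
      forall v : 'cV[C]_N, (exists u, v = Q *m u) <-> in_low_span A tau v].

Definition ground_state (N : nat) (H : 'M[C]_N) (psi : 'cV[C]_N) : Prop :=
  vnorm psi = 1 /\
  exists E : C, H *m psi = E *: psi /\
    forall (mu : C) (v : 'cV[C]_N), v != 0 -> H *m v = mu *: v -> E <= mu.

Definition rvnorm (k : nat) (v : 'cV[R]_k) : R :=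
  Num.sqrt (\sum_(i < k) (v i 0) ^+ 2).

Definition opnorm_le1 (k : nat) (h : 'M[R]_k) : Prop :=
  forall v : 'cV[R]_k, rvnorm (h *m v) <= rvnorm v.

Definition psd (k : nat) (S : 'M[R]_k) : Prop :=
  S^T = S /\ forall v : 'cV[R]_k, 0 <= (v^T *m S *m v) 0 0.

(* t is the trace norm of h: t = tr |h| with |h| = sqrt(h^T h) the unique
   positive semidefinite square root of h^T h *)
Definition trace_norm_is (k : nat) (h : 'M[R]_k) (t : R) : Prop :=
  exists S : 'M[R]_k, [/\ psd S, S *m S = h^T *m h & t = \tr S].

(* basis vector x : 'I_(2^n) encodes occupations; mode j (0-based) is occupied
   iff bit j of x is 1 *)
Definition occ (x j : nat) : bool := odd (x %/ 2 ^ j)%N.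

(* annihilation operator a_j (Jordan-Wigner convention):
   a_j |x> = (-1)^(sum_{k<j} x_k) |x - e_j> if x_j = 1, and 0 otherwise.
   Entry (y, x) is <y| a_j |x>. *)
Definition annih (n : nat) (j : 'I_n) : 'M[C]_(2 ^ n) :=
  \matrix_(y, x)
    if occ x j && (val y == (val x - 2 ^ j)%N)
    then (-1) ^+ (\sum_(k < n | (k < j)%N) (occ x k : nat))%N
    else 0.

Definition creat (n : nat) (j : 'I_n) : 'M[C]_(2 ^ n) := mxadj (annih j).

(* Majorana operators, 0-based: c_(2j) = a_j + a_j^dag  (paper's c_{2j-1}),
   c_(2j+1) = -i (a_j - a_j^dag)  (paper's c_{2j}) *)
Definition majorana (n : nat) (p : 'I_(2 * n)) : 'M[C]_(2 ^ n) :=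
  let j := (p %/ 2)%N in
  match ltnP j n with
  | LtnNotGeq Hj =>
      let jj := Ordinal Hj in
      if odd p then (- (complex.Complex 0 1 : C)) *: (annih jj - creat jj) else annih jj + creat jj
  | GeqNotLtn _ => 0
  end.

Definition H0 (n : nat) (h : 'M[R]_(2 * n)) (t1 : R) : 'M[C]_(2 ^ n) :=
  (t1 / 4)%:C%:M +
  ((complex.Complex 0 1 : C) / 4) *: \sum_(p < 2 * n) \sum_(q < 2 * n)
                   (h p q)%:C *: (majorana p *m majorana q).

(* H_imp = sum_{x in {0,1}^m, |x| even} g_x c_1^{x_1} ... c_m^{x_m}
   (the first m Majorana modes; m <= 2n) *)
Definition Himp (n m : nat) (g : {ffun 'I_m -> bool} -> C) : 'M[C]_(2 ^ n) :=
  \sum_(x : {ffun 'I_m -> bool} | ~~ odd (\sum_(k < m) (x k : nat)))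
     g x *: \prod_(k < m)
        (if x k then
           (if (k < 2 * n)%N =P true is ReflectT Hk
            then majorana (Ordinal Hk) else 0)
         else 1%:M).

End Defs.

(* Main.v *)
Require Import Defs.
From HB Require Import structures.
From mathcomp Require Import all_boot all_order all_algebra.
From mathcomp Require Import complex.
From mathcomp Require Import all_classical all_reals topology normedtype derive realfun sequences exp.
From mathcomp Require Import ring lra.
Import Order.TTheory GRing.Theory Num.Theory.
Import numFieldNormedType.Exports.
Set Implicit Arguments. Unset Strict Implicit. Unset Printing Implicit Defensive.
Local Open Scope ring_scope.

(** Split H0 = X + W, where X keeps the bath-bath part of the quadratic form and
    W contains every term with an impurity Majorana; X commutes with H_imp.
    Since X is quadratic, e^{tX} W e^{-tX} is obtained from W by acting on the
    one-particle coefficients, and there are only m coupling terms, so its norm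
    is at most (3/4) m e^{|t|}.

    Filling the negative modes of the bath on top of a ground state of H_imp, and
    comparing with the vacuum of H0, gives E - min H_imp <= (3/2) m.  Hence
    phi(s) = e^{sX} psi satisfies (X + W_s + H_imp - E) phi = 0, and Gronwall's
    inequality bounds |e^{bX} psi|.  A second Gronwall estimate bounds
    e^{-bX} e^{bH0}.  With chi = (1 - Q) psi, which satisfies
    |e^{-b H0} chi| <= e^{-b tau} |chi|, the identity
    |chi|^2 = <e^{-bX} chi, e^{bX} psi> yields
    |chi| <= exp(- b tau + (3/2) m (b + e^b - 1)), and b solves
    8 m e^{4b} = tau. *)

(** * Complex vectors with their real inner product *)

Section InnerProduct.
Variable R : realType.
Local Notation C := R[i].
Local Open Scope complex_scope.

Definition adj (m n : nat) (A : 'M[C]_(m, n)) : 'M[C]_(n, m) := map_mx (@conjc R) A^T.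

Lemma mxadjE n (A : 'M[C]_n) : mxadj A = adj A.
Proof. by apply/matrixP => i j; rewrite !mxE. Qed.

Lemma adjK m n (A : 'M[C]_(m, n)) : adj (adj A) = A.
Proof. by apply/matrixP => i j; rewrite !mxE conjcK. Qed.

Lemma adjM m n p (A : 'M[C]_(m, n)) (B : 'M[C]_(n, p)) : adj (A *m B) = adj B *m adj A.
Proof. by rewrite /adj trmx_mul map_mxM. Qed.

Lemma adjD m n (A B : 'M[C]_(m, n)) : adj (A + B) = adj A + adj B.
Proof. by rewrite /adj linearD map_mxD. Qed.

Lemma adjZ m n a (A : 'M[C]_(m, n)) : adj (a *: A) = conjc a *: adj A.
Proof. by apply/matrixP => i j; rewrite !mxE rmorphM. Qed.

Lemma adj0 m n : adj (0 : 'M[C]_(m, n)) = 0.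
Proof. by apply/matrixP => i j; rewrite !mxE rmorph0. Qed.

Lemma adj_scalar n (a : C) : adj (a%:M : 'M_n) = (conjc a)%:M.
Proof. by rewrite /adj tr_scalar_mx map_scalar_mx. Qed.

Lemma adj_sum m n (I : Type) (r : seq I) (P : pred I) (F : I -> 'M[C]_(m, n)) :
  adj (\sum_(i <- r | P i) F i) = \sum_(i <- r | P i) adj (F i).
Proof. by elim/big_rec2: _ => [|i x y _ <-]; rewrite ?adj0 ?adjD. Qed.

Lemma complexP (x y : C) : complex.Re x = complex.Re y -> complex.Im x = complex.Im y -> x = y.
Proof. by case: x => a b; case: y => c d /= -> ->. Qed.

Lemma ReD (x y : C) : complex.Re (x + y) = complex.Re x + complex.Re y.
Proof. by case: x => a b; case: y. Qed.

Lemma ImD (x y : C) : complex.Im (x + y) = complex.Im x + complex.Im y.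
Proof. by case: x => a b; case: y. Qed.

Lemma ReM (x y : C) :
  complex.Re (x * y) = complex.Re x * complex.Re y - complex.Im x * complex.Im y.
Proof. by case: x => a b; case: y. Qed.

Lemma ImM (x y : C) :
  complex.Im (x * y) = complex.Re x * complex.Im y + complex.Im x * complex.Re y.
Proof. by case: x => a b; case: y. Qed.

Lemma Re_sum (I : Type) (r : seq I) (P : pred I) (F : I -> C) :
  complex.Re (\sum_(i <- r | P i) F i) = \sum_(i <- r | P i) complex.Re (F i).
Proof. by elim/big_rec2: _ => [|i x y _ <-]; rewrite ?ReD. Qed.

Lemma Im_sum (I : Type) (r : seq I) (P : pred I) (F : I -> C) :
  complex.Im (\sum_(i <- r | P i) F i) = \sum_(i <- r | P i) complex.Im (F i).
Proof. by elim/big_rec2: _ => [|i x y _ <-]; rewrite ?ImD. Qed.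

Lemma conj_real (x : R) : conjc x%:C = x%:C :> C.
Proof. by apply: complexP => //=; rewrite oppr0. Qed.

(** Keeping only the real part turns complex vectors into a real Euclidean space, so norms,
    quadratic forms of Hermitian matrices and their derivatives all take values in [R]. *)
Definition ip (N : nat) (u v : 'cV[C]_N) : R := complex.Re ((adj u *m v) 0 0).

Definition ns (N : nat) (v : 'cV[C]_N) : R := ip v v.

Variable N : nat.
Implicit Types (u v w : 'cV[C]_N) (A B : 'M[C]_N).

Lemma ipE u v : ip u v = \sum_i (complex.Re (u i 0) * complex.Re (v i 0)
                                  + complex.Im (u i 0) * complex.Im (v i 0)).
Proof.
rewrite /ip mxE Re_sum; apply: eq_bigr => i _; rewrite !mxE.
by case: (u i 0) => a b; case: (v i 0) => c d /=; rewrite mulNr opprK.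
Qed.

Lemma ipC u v : ip u v = ip v u.
Proof. by rewrite !ipE; apply: eq_bigr => i _; rewrite mulrC [X in _ + X]mulrC. Qed.

Lemma ipDr u v w : ip u (v + w) = ip u v + ip u w.
Proof. by rewrite /ip mulmxDr mxE ReD. Qed.

Lemma ipDl u v w : ip (u + v) w = ip u w + ip v w.
Proof. by rewrite ipC ipDr !(ipC w). Qed.

Lemma ip0r u : ip u 0 = 0.
Proof. by rewrite /ip mulmx0 mxE. Qed.

Lemma ip0l u : ip 0 u = 0.
Proof. by rewrite ipC ip0r. Qed.

Lemma ipZr (a : R) u v : ip u (a%:C *: v) = a * ip u v.
Proof. by rewrite /ip -scalemxAr mxE ReM /= mul0r subr0. Qed.

Lemma ipZl (a : R) u v : ip (a%:C *: u) v = a * ip u v.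
Proof. by rewrite ipC ipZr ipC. Qed.

Lemma ipNr u v : ip u (- v) = - ip u v.
Proof.
by apply/eqP; rewrite -addr_eq0 addrC -ipDr subrr ip0r.
Qed.

Lemma ipNl u v : ip (- u) v = - ip u v.
Proof. by rewrite ipC ipNr ipC. Qed.

Lemma ip_sumr u (I : Type) (r : seq I) (P : pred I) (F : I -> 'cV[C]_N) :
  ip u (\sum_(i <- r | P i) F i) = \sum_(i <- r | P i) ip u (F i).
Proof. by elim/big_rec2: _ => [|i x y _ <-]; rewrite ?ip0r ?ipDr. Qed.

Lemma ip_adj A u v : ip (A *m u) v = ip u (adj A *m v).
Proof. by rewrite /ip adjM mulmxA. Qed.

Lemma nsE u : ns u = \sum_i (complex.Re (u i 0) ^+ 2 + complex.Im (u i 0) ^+ 2).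
Proof. by rewrite /ns ipE. Qed.

Lemma ns_ge0 u : 0 <= ns u.
Proof. by rewrite nsE sumr_ge0 // => i _; rewrite addr_ge0 ?sqr_ge0. Qed.

Lemma ns_eq0 u : (ns u == 0) = (u == 0).
Proof.
apply/eqP/eqP => [|->]; last by rewrite /ns ip0r.
rewrite nsE => /psumr_eq0P H; apply/matrixP => i j; rewrite !mxE ord1.
have := H _ i isT; move=> {}H.
have {H} : complex.Re (u i 0) ^+ 2 + complex.Im (u i 0) ^+ 2 == 0.
  by apply/eqP/H => k _; rewrite addr_ge0 ?sqr_ge0.
rewrite paddr_eq0 ?sqr_ge0 // !sqrf_eq0 => /andP [/eqP a /eqP b].
exact: complexP.
Qed.

Lemma ns_gt0 u : (0 < ns u) = (u != 0).
Proof. by rewrite lt_neqAle ns_ge0 andbT eq_sym ns_eq0. Qed.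

Lemma vnormE u : vnorm u = Num.sqrt (ns u).
Proof. by rewrite /vnorm nsE. Qed.

Lemma nsZ (a : R) u : ns (a%:C *: u) = a ^+ 2 * ns u.
Proof. by rewrite /ns ipZr ipZl mulrA. Qed.

Lemma nsD u v : ns (u + v) = ns u + 2 * ip u v + ns v.
Proof. by rewrite /ns ipDr !ipDl (ipC v u); ring. Qed.

Lemma nsB u v : ns (u - v) = ns u - 2 * ip u v + ns v.
Proof. by rewrite nsD ipNr mulrN /ns ipNr ipNl opprK. Qed.

(** Expand the nonnegative squares [ns (k u + v)] and [ns (k u - v)]. The weight [k] stays free so
    that each use can tune it. *)
Lemma ip_amgm (k : R) u v : 0 < k -> `|ip u v| <= k / 2 * ns u + ns v / (2 * k).
Proof.
move=> k0.
have H1 := ns_ge0 (k%:C *: u + v); have H2 := ns_ge0 (k%:C *: u - v).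
rewrite nsD nsZ ipZl in H1; rewrite nsB nsZ ipZl in H2.
have -> : k / 2 * ns u + ns v / (2 * k) = (k ^+ 2 * ns u + ns v) / (2 * k).
  by field; rewrite gt_eqF.
rewrite ler_norml; apply/andP; split.
  by rewrite lerNl ler_pdivlMr ?mulr_gt0 // -subr_ge0; nra.
by rewrite ler_pdivlMr ?mulr_gt0 //; nra.
Qed.

Lemma cauchy_schwarz u v : ip u v <= Num.sqrt (ns u) * Num.sqrt (ns v).
Proof.
have [->|u0] := eqVneq u 0; first by rewrite ip0l mulr_ge0 ?sqrtr_ge0.
have [->|v0] := eqVneq v 0; first by rewrite ip0r mulr_ge0 ?sqrtr_ge0.
have a0 : 0 < Num.sqrt (ns u) by rewrite sqrtr_gt0 ns_gt0.
have b0 : 0 < Num.sqrt (ns v) by rewrite sqrtr_gt0 ns_gt0.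
apply: le_trans (ler_norm _) _.
(* The weight |v| / |u| is optimal and makes the right-hand side collapse to |u| |v|. *)
apply: le_trans (ip_amgm u v (divr_gt0 b0 a0)) _.
rewrite -{2}(sqr_sqrtr (ns_ge0 u)) -{2}(sqr_sqrtr (ns_ge0 v)).
move: a0 b0; set a := Num.sqrt _; set b := Num.sqrt _ => a0 b0.
rewrite [leLHS](_ : _ = a * b) //; by field; rewrite !gt_eqF.
Qed.

End InnerProduct.

(** * Functional calculus of Hermitian matrices *)

Section Spectral.
Variable R : realType.
Local Notation C := R[i].
Local Open Scope complex_scope.

Definition dmx N (d : 'I_N -> R) : 'M[C]_N := diag_mx (\row_k (d k)%:C).

(** In this convention the eigenvectors are the columns of [adj U], and [U *m v] holds the
    coordinates of [v] in the eigenbasis. *)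
Record spectral_decomp N (A U : 'M[C]_N) (d : 'I_N -> R) : Prop := SpectralDecomp {
  sd_l : adj U *m U = 1%:M;
  sd_r : U *m adj U = 1%:M;
  sd_E : A = adj U *m dmx d *m U }.

Lemma hermitian_spectral N (A : 'M[C]_N) :
  adj A = A -> exists U d, spectral_decomp A U d.
Proof.
move=> hA.
have tE (B : 'M[C]_N) : map_mx Num.conj B^T = adj B.
  by apply/matrixP => i j; rewrite !mxE.
have hs : A \is hermsymmx.
  by apply/is_hermitianmxP; rewrite expr0 scale1r tE hA.
have nA : A \is normalmx by exact: hermitian_normalmx.
have dr := hermitian_spectral_diag_real hs.
have /orthomx_spectralP E := nA.
set U := spectralmx A in E.
have Uu : U \is unitarymx := spectral_unitarymx A.
exists U, (fun k => complex.Re (spectral_diag A 0 k)).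
have r : U *m adj U = 1%:M by move/unitarymxP: Uu; rewrite tE.
have l : adj U *m U = 1%:M by apply: mulmx1C.
apply: SpectralDecomp; [exact: l | exact: r |].
rewrite {1}E (invmx_unitary Uu) tE; congr (_ *m _ *m _).
rewrite /dmx; congr diag_mx; apply/matrixP => i k; rewrite !mxE ord1.
by rewrite RRe_real //; exact: (mxOverP dr).
Qed.

Lemma adj_dmx N (d : 'I_N -> R) : adj (dmx d) = dmx d.
Proof.
apply/matrixP => i j; rewrite !mxE; case: eqVneq => [->|ne]; last by rewrite !mulr0n rmorph0.
by rewrite !mulr1n; apply: complexP => //=; rewrite oppr0.
Qed.

Lemma dmxM N (d e : 'I_N -> R) : dmx d *m dmx e = dmx (fun k => d k * e k).
Proof.
rewrite /dmx mulmx_diag; congr diag_mx; apply/matrixP => i k.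
by rewrite !mxE rmorphM.
Qed.

Lemma dmxE N (d : 'I_N -> R) (v : 'cV[C]_N) k : (dmx d *m v) k 0 = (d k)%:C * v k 0.
Proof. by rewrite /dmx mul_diag_mx !mxE. Qed.

Lemma dmx_cst N (a : R) : dmx (fun _ : 'I_N => a) = (a%:C)%:M.
Proof.
by rewrite -diag_const_mx /dmx; congr diag_mx; apply/matrixP => i k; rewrite !mxE.
Qed.

Lemma eq_dmx N (d e : 'I_N -> R) : d =1 e -> dmx d = dmx e.
Proof. by move=> E; rewrite /dmx; congr diag_mx; apply/matrixP => i k; rewrite !mxE E. Qed.

Lemma ip_dmx N (d : 'I_N -> R) (v : 'cV[C]_N) :
  ip v (dmx d *m v) = \sum_k d k * (complex.Re (v k 0) ^+ 2 + complex.Im (v k 0) ^+ 2).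
Proof.
rewrite ipE; apply: eq_bigr => k _; rewrite dmxE ReM ImM /= mul0r subr0 mul0r addr0.
by ring.
Qed.

Lemma ns_unitary N (U : 'M[C]_N) (v : 'cV[C]_N) : adj U *m U = 1%:M -> ns (U *m v) = ns v.
Proof. by move=> h; rewrite /ns ip_adj mulmxA h mul1mx. Qed.

Section Calculus.
Variables (N : nat) (A U : 'M[C]_N) (d : 'I_N -> R).
Hypothesis sd : spectral_decomp A U d.

(** This is f(A) in the sense of functional calculus. *)
Definition fmx (f : R -> R) : 'M[C]_N := adj U *m dmx (f \o d) *m U.

Lemma sd_fmx : A = fmx id. Proof. exact: sd_E sd. Qed.

Lemma fmxM f g : fmx f *m fmx g = fmx (fun x => f x * g x).
Proof.
rewrite /fmx -!mulmxA (mulmxA U) (sd_r sd) mul1mx (mulmxA (dmx _)) dmxM.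
by [].
Qed.

Lemma fmx_cst a : fmx (fun=> a) = (a%:C)%:M.
Proof.
by rewrite /fmx (@eq_dmx _ _ (fun=> a)) // dmx_cst mul_mx_scalar -scalemxAl (sd_l sd) scalemx1.
Qed.

Lemma eq_fmx f g : f =1 g -> fmx f = fmx g.
Proof. by move=> E; rewrite /fmx (@eq_dmx _ _ (g \o d)) // => k /=. Qed.

Lemma adj_fmx f : adj (fmx f) = fmx f.
Proof. by rewrite /fmx !adjM adjK adj_dmx mulmxA. Qed.

Lemma ip_fmx f v : ip v (fmx f *m v) =
  \sum_k f (d k) * (complex.Re ((U *m v) k 0) ^+ 2 + complex.Im ((U *m v) k 0) ^+ 2).
Proof. by rewrite -ip_dmx ip_adj /fmx !mulmxA. Qed.

Lemma ns_sd v : ns v = \sum_k (complex.Re ((U *m v) k 0) ^+ 2 + complex.Im ((U *m v) k 0) ^+ 2).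
Proof. by rewrite -(ns_unitary v (sd_l sd)) nsE. Qed.

Lemma ip_fmx_ge f a v : (forall k, a <= f (d k)) -> a * ns v <= ip v (fmx f *m v).
Proof.
move=> h; rewrite ip_fmx ns_sd mulr_sumr; apply: ler_sum => k _.
by rewrite ler_wpM2r // addr_ge0 ?sqr_ge0.
Qed.

Lemma ip_fmx_le f a v : (forall k, f (d k) <= a) -> ip v (fmx f *m v) <= a * ns v.
Proof.
move=> h; rewrite ip_fmx ns_sd mulr_sumr; apply: ler_sum => k _.
by rewrite ler_wpM2r // addr_ge0 ?sqr_ge0.
Qed.

Lemma ns_fmx f v : ns (fmx f *m v) = ip v (fmx (fun x => f x ^+ 2) *m v).
Proof. by rewrite /ns ip_adj adj_fmx mulmxA fmxM. Qed.

Definition evec k : 'cV[C]_N := col k (adj U).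

Lemma evecE k : evec k = adj U *m delta_mx k 0.
Proof. by rewrite /evec colE. Qed.

Lemma fmx_evec f k : fmx f *m evec k = (f (d k))%:C *: evec k.
Proof.
rewrite evecE /fmx -!mulmxA (mulmxA U) (sd_r sd) mul1mx.
have -> : dmx (f \o d) *m (delta_mx k 0 : 'cV[C]_N) = (f (d k))%:C *: delta_mx k 0.
  apply/matrixP => i j; rewrite !ord1 dmxE !mxE andbT.
  by case: eqVneq => [->|_]; rewrite ?mulr0.
by rewrite scalemxAr.
Qed.

Lemma evec_ip j k : adj (evec j) *m evec k = (j == k)%:R%:M.
Proof.
rewrite !evecE adjM adjK -mulmxA (mulmxA U) (sd_r sd) mul1mx.
apply/matrixP => a b; rewrite !mxE !ord1 (bigD1 j) //= !mxE eqxx big1 ?addr0.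
  by rewrite ?eqxx conjc_nat mulr1n !andbT mul1r.
by move=> i /negPf ne; rewrite !mxE ne conjc_nat mul0r.
Qed.

Lemma ns_evec k : ns (evec k) = 1.
Proof. by rewrite /ns /ip evec_ip eqxx !mxE. Qed.

Lemma evec_neq0 k : evec k != 0.
Proof. by rewrite -ns_gt0 ns_evec. Qed.

Lemma evec_eigen k : A *m evec k = (d k)%:C *: evec k.
Proof. by rewrite {1}sd_fmx fmx_evec. Qed.

Lemma ip_sd_ge a v : (forall k, a <= d k) -> a * ns v <= ip v (A *m v).
Proof. by rewrite sd_fmx; apply: ip_fmx_ge. Qed.

(* In the eigenbasis of A, the (k, l) entry of Z vanishes unless d_k = d_l + mu. *)
Lemma fmx_intertwine (Z : 'M[C]_N) (mu : R) (f : R -> R) :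
  A *m Z = Z *m A + mu%:C *: Z -> fmx f *m Z = Z *m fmx (fun x => f (x + mu)).
Proof.
move=> E; have [Y YD] : exists Y, Y = U *m Z *m adj U by exists (U *m Z *m adj U).
have ZE : Z = adj U *m Y *m U.
  by rewrite YD !mulmxA (sd_l sd) mul1mx -mulmxA (sd_l sd) mulmx1.
have YE : dmx d *m Y = Y *m dmx d + mu%:C *: Y.
  have := congr1 (fun B => U *m B *m adj U) E.
  rewrite mulmxDr mulmxDl -scalemxAr -scalemxAl -YD (sd_E sd) !mulmxA (sd_r sd) mul1mx.
  by rewrite -!mulmxA (sd_r sd) mulmx1 YD !mulmxA.
have YE2 : dmx (f \o d) *m Y = Y *m dmx ((fun x => f (x + mu)) \o d).
  apply/matrixP => k l; have := congr1 (fun B : 'M_N => B k l) YE.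
  rewrite /dmx !mul_diag_mx !mul_mx_diag !mxE => E'.
  have [->|nz] := eqVneq (Y k l) 0; first by rewrite mul0r mulr0.
  have : (d k)%:C = (d l + mu)%:C.
    by apply: (mulIf nz); rewrite E' rmorphD /= mulrDl; congr (_ + _); rewrite mulrC.
  by move/complexI => /= ->; rewrite mulrC.
rewrite /fmx [in LHS]ZE [in RHS]ZE -!mulmxA (mulmxA U) (sd_r sd) mul1mx.
by rewrite (mulmxA (dmx _)) YE2 -!mulmxA (mulmxA U (adj U)) (sd_r sd) mul1mx.
Qed.

Lemma fmx_comm (Z : 'M[C]_N) f : A *m Z = Z *m A -> fmx f *m Z = Z *m fmx f.
Proof.
move=> E; have E0 : A *m Z = Z *m A + (0 : R)%:C *: Z by rewrite scale0r addr0.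
rewrite (fmx_intertwine f E0).
by congr (_ *m _); apply: eq_fmx => x; rewrite addr0.
Qed.

End Calculus.
End Spectral.

(** * Propagators and Gronwall estimates *)

Section Calculus.
Variable R : realType.
Local Notation C := R[i].
Local Open Scope complex_scope.

Lemma is_derive_ext (f g : R -> R) (x a : R) : f =1 g -> is_derive x 1 f a -> is_derive x 1 g a.
Proof. by move=> /funext ->. Qed.

Lemma is_derive_mul (f g : R -> R) (x a b : R) :
  is_derive x 1 f a -> is_derive x 1 g b ->
  is_derive x 1 (fun t => f t * g t) (f x * b + g x * a).
Proof. by move=> hf hg; apply: is_deriveM. Qed.

Lemma is_derive_add (f g : R -> R) (x a b : R) :
  is_derive x 1 f a -> is_derive x 1 g b -> is_derive x 1 (fun t => f t + g t) (a + b).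
Proof. by move=> hf hg; apply: is_deriveD. Qed.

Lemma is_derive_scale (f : R -> R) (x a k : R) :
  is_derive x 1 f a -> is_derive x 1 (fun t => k * f t) (k * a).
Proof. by move=> hf; exact: (@is_deriveZ _ _ _ f k x 1 a hf). Qed.

Lemma is_derive_bigsum (I : Type) (r : seq I) (f : I -> R -> R) (x : R) (a : I -> R) :
  (forall i, is_derive x 1 (f i) (a i)) ->
  is_derive x 1 (fun t => \sum_(i <- r) f i t) (\sum_(i <- r) a i).
Proof.
move=> h; elim: r => [|i r IH].
  rewrite big_nil; apply: is_derive_ext (is_derive_cst 0 x 1) => t.
  by rewrite big_nil.
rewrite big_cons; apply: is_derive_ext (is_derive_add (h i) IH) => t.
by rewrite big_cons.
Qed.

Lemma is_derive_exp (c x : R) :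
  is_derive x 1 (fun t => expR (c * t)) (c * expR (c * x)).
Proof.
have h : is_derive x 1 (fun t : R => c * t) c.
  by rewrite -[X in is_derive _ _ _ X]mulr1; apply: is_derive_scale; exact: is_derive_id.
by have := @is_derive1_comp R expR _ x _ _ (is_derive_expR _) h; rewrite mulrC.
Qed.

(** Multiply [f] by the integrating factor [expR (K s)], where [- K] is the antiderivative of
    [a + b * expR s] that vanishes at 0; the product is nonincreasing on the half-line. *)
Lemma gronwall (f f' : R -> R) (a b t : R) :
  (forall s : R, is_derive s 1 f (f' s)) ->
  (forall s : R, 0 <= s -> f' s <= (a + b * expR s) * f s) ->
  0 <= t -> f t <= expR (a * t + b * (expR t - 1)) * f 0.
Proof.
move=> df hf t0.
pose K s := - (a * s + b * (expR s - 1)).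
pose g s := expR (K s) * f s.
have dK (s : R) : is_derive s 1 K (- (a + b * expR s)).
  apply: is_deriveN; apply: is_derive_add.
    by rewrite -[X in is_derive _ _ _ X]mulr1; apply: is_derive_scale; exact: is_derive_id.
  apply: is_derive_scale; rewrite -[X in is_derive _ _ _ X]addr0.
  by apply: is_derive_add.
have dg (s : R) : is_derive s 1 g (expR (K s) * (f' s - (a + b * expR s) * f s)).
  have hK := @is_derive1_comp R expR K s _ _ (is_derive_expR _) (dK s).
  have := is_derive_mul hK (df s).
  by congr (is_derive _ _ _ _); rewrite /= ; ring.
have : g t <= g 0.
  apply: (@ler0_derive1_nincry R g 0) => //.
  - move=> x; rewrite in_itv /= andbT => x0.
    rewrite derive1E; case: (dg x) => _ ->; rewrite pmulr_rle0 ?expR_gt0 // subr_le0.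
    exact: hf (ltW x0).
  - apply: continuous_subspaceT => x; apply: differentiable_continuous.
    by apply/derivable1_diffP; case: (dg x).
rewrite /g {2}/K expR0 subrr !mulr0 addr0 oppr0 expR0 mul1r => H.
by rewrite -ler_pdivrMl ?expR_gt0 // -expRN.
Qed.

(** Differentiation is taken entry by entry on real and imaginary parts, which reduces it to real
    functions of one variable. *)
Definition vder N (F : R -> 'cV[C]_N) (D : 'cV[C]_N) (s : R) : Prop :=
  forall i, is_derive s 1 (fun t => complex.Re (F t i 0)) (complex.Re (D i 0)) /\
            is_derive s 1 (fun t => complex.Im (F t i 0)) (complex.Im (D i 0)).

Variable N : nat.
Implicit Types (F : R -> 'cV[C]_N) (D : 'cV[C]_N).

Lemma vder_cst (v : 'cV[C]_N) s : vder (fun=> v) 0 s.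
Proof. by move=> i; rewrite mxE; split; exact: is_derive_cst. Qed.

Lemma vder_mulmx (A : 'M[C]_N) F D s : vder F D s -> vder (fun t => A *m F t) (A *m D) s.
Proof.
move=> h i; split; rewrite !mxE ?Re_sum ?Im_sum.
- apply: (@is_derive_ext (fun t => \sum_j (complex.Re (A i j) * complex.Re (F t j 0)
      + - complex.Im (A i j) * complex.Im (F t j 0)))).
    by move=> t; rewrite mxE Re_sum; apply: eq_bigr => j _; rewrite ReM mulNr.
  apply: is_derive_bigsum => j; rewrite ReM -mulNr.
  by apply: is_derive_add; apply: is_derive_scale; case: (h j).
- apply: (@is_derive_ext (fun t => \sum_j (complex.Re (A i j) * complex.Im (F t j 0)
      + complex.Im (A i j) * complex.Re (F t j 0)))).
    by move=> t; rewrite mxE Im_sum; apply: eq_bigr => j _; rewrite ImM.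
  apply: is_derive_bigsum => j; rewrite ImM.
  by apply: is_derive_add; apply: is_derive_scale; case: (h j).
Qed.

Lemma vder_dmx_exp (d : 'I_N -> R) F D s : vder F D s ->
  vder (fun t => dmx (fun k => expR (d k * t)) *m F t)
       (dmx (fun k => expR (d k * s)) *m (D + dmx d *m F s)) s.
Proof.
move=> h i; have [h1 h2] := h i; have he := is_derive_exp (d i) s.
split; rewrite dmxE mxE dmxE ?ReM ?ImM ?ReD ?ImD ?ReM ?ImM /= !mul0r ?subr0 ?addr0.
- apply: (@is_derive_ext (fun t => expR (d i * t) * complex.Re (F t i 0))).
    by move=> t; rewrite dmxE ReM /= mul0r subr0.
  by have := is_derive_mul he h1; congr (is_derive _ _ _ _); ring.
- apply: (@is_derive_ext (fun t => expR (d i * t) * complex.Im (F t i 0))).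
    by move=> t; rewrite dmxE ImM /= mul0r addr0.
  by have := is_derive_mul he h2; congr (is_derive _ _ _ _); ring.
Qed.

Lemma vder_ns F D s : vder F D s -> is_derive s 1 (fun t => ns (F t)) (2 * ip (F s) D).
Proof.
move=> h; apply: (@is_derive_ext (fun t => \sum_i (complex.Re (F t i 0) * complex.Re (F t i 0)
      + complex.Im (F t i 0) * complex.Im (F t i 0)))).
  by move=> t; rewrite /ns ipE.
rewrite ipE mulr_sumr; apply: is_derive_bigsum => i; have [h1 h2] := h i.
have := is_derive_add (is_derive_mul h1 h1) (is_derive_mul h2 h2).
by congr (is_derive _ _ _ _); ring.
Qed.

(** * Imaginary-time propagators *)

Section Propagator.
Variables (A U : 'M[C]_N) (d : 'I_N -> R).
Hypothesis sd : spectral_decomp A U d.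

(** This is e^{tA} with real t: Hermitian and invertible, but in general not unitary, so norms
    evolve and have to be estimated. *)
Definition prop (t : R) : 'M[C]_N := fmx U d (fun x => expR (t * x)).

Lemma prop0 : prop 0 = 1%:M.
Proof.
rewrite /prop (@eq_fmx _ _ _ _ _ (fun=> 1)) ?(fmx_cst sd) // => x.
by rewrite mul0r expR0.
Qed.

Lemma propD s t : prop s *m prop t = prop (s + t).
Proof. by rewrite /prop (fmxM sd); apply: eq_fmx => x; rewrite -expRD mulrDl. Qed.

Lemma propNK t : prop (- t) *m prop t = 1%:M.
Proof. by rewrite propD addNr prop0. Qed.

Lemma propKN t : prop t *m prop (- t) = 1%:M.
Proof. by rewrite propD subrr prop0. Qed.

Lemma adj_prop t : adj (prop t) = prop t.
Proof. exact: adj_fmx. Qed.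

Lemma prop_comm (Z : 'M[C]_N) t : A *m Z = Z *m A -> prop t *m Z = Z *m prop t.
Proof. exact: (fmx_comm sd). Qed.

(** [Z] raises eigenvalues of [A] by [mu], hence conjugation by e^{tA} only multiplies it by a
    scalar. *)
Lemma prop_intertwine (Z : 'M[C]_N) (mu t : R) :
  A *m Z = Z *m A + mu%:C *: Z -> prop t *m Z = (expR (t * mu))%:C *: (Z *m prop t).
Proof.
move/(fmx_intertwine sd) ->; rewrite scalemxAr; congr (_ *m _).
rewrite -mul_scalar_mx -(fmx_cst sd) (fmxM sd); apply: eq_fmx => x.
by rewrite -expRD mulrDr addrC.
Qed.

(** Leibniz rule for e^{ctA} F(t). The curve [F] may itself move, so that two propagators can be
    nested. *)
Lemma vder_prop (c : R) F D s : vder F D s ->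
  vder (fun t => prop (c * t) *m F t) (prop (c * s) *m (D + c%:C *: (A *m F s))) s.
Proof.
(* In the coordinates [U *m F t] the propagator is diagonal, and the rule is the scalar product rule
   in each entry. *)
move=> h; have h1 := vder_mulmx U h.
have h2 := vder_mulmx (adj U) (vder_dmx_exp (fun k => c * d k) h1).
move=> i; have [h3 h4] := h2 i.
have E t : dmx ((fun x => expR (c * t * x)) \o d) = dmx (fun k => expR (c * d k * t)) :> 'M[C]_N.
  by apply: eq_dmx => k /=; rewrite mulrAC.
have E1 t : prop (c * t) *m F t = adj U *m (dmx (fun k => expR (c * d k * t)) *m (U *m F t)).
  by rewrite /prop /fmx E !mulmxA.
have E2 : prop (c * s) *m (D + c%:C *: (A *m F s)) =
   adj U *m (dmx (fun k => expR (c * d k * s)) *m (U *m D + dmx (fun k => c * d k) *m (U *m F s))).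
  rewrite /prop /fmx E -!mulmxA; congr (_ *m (_ *m _)); rewrite mulmxDr; congr (_ + _).
  rewrite -(dmxM (fun=> c) d) dmx_cst -!mulmxA mul_scalar_mx -scalemxAr; congr (_ *: _).
  by rewrite {1}(sd_E sd) !mulmxA (sd_r sd) mul1mx.
rewrite E2; split.
- by apply: is_derive_ext h3 => t; rewrite E1.
- by apply: is_derive_ext h4 => t; rewrite E1.
Qed.

End Propagator.
End Calculus.

(** * Clifford generators and quadratic forms *)

Section Clifford.
Variable R : realType.
Local Notation C := R[i].
Local Open Scope complex_scope.

Definition conjv m n (A : 'M[C]_(m, n)) : 'M[C]_(m, n) := map_mx (@conjc R) A.

(** Each [D i] anticommutes with itself, so its square is zero. If [D i *m w] is nonzero it replaces
    [w]: it is killed by [D i], and anticommutation keeps it in the kernels already reached. The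
    predicate [P] carries along an invariant of the starting vector, such as membership in an
    eigenspace. *)
Lemma joint_kernel (N : nat) (I : eqType) (D : I -> 'M[C]_N) (P : 'cV[C]_N -> Prop)
    (s : seq I) (v : 'cV[C]_N) :
  (forall i j, i \in s -> j \in s -> D i *m D j = - (D j *m D i)) ->
  (forall i w, i \in s -> P w -> P (D i *m w)) ->
  v != 0 -> P v ->
  exists w, [/\ w != 0, P w & forall i, i \in s -> D i *m w = 0].
Proof.
move=> hD hP v0 Pv; elim: s hD hP => [|i s IH] hD hP; first by exists v.
have [||w [w0 Pw kw]] := IH.
- by move=> j k js ks; apply: hD; rewrite inE ?js ?ks orbT.
- by move=> j w js; apply: hP; rewrite inE js orbT.
have is_ : i \in i :: s by rewrite mem_head.
have [E|nz] := eqVneq (D i *m w) 0.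
  by exists w; split=> // j; rewrite inE => /predU1P [->|/kw].
exists (D i *m w); split=> //; first exact: hP.
have sq0 : D i *m D i = 0.
  have := hD i i is_ is_ => /eqP; rewrite -addr_eq0 -mulr2n -scaler_nat scaler_eq0.
  by rewrite pnatr_eq0 => /eqP.
move=> j; rewrite inE => /predU1P [->|js]; first by rewrite mulmxA sq0 mul0mx.
by rewrite mulmxA hD // ?inE ?js ?orbT // mulNmx -mulmxA kw // mulmx0 oppr0.
Qed.

Variables (K N : nat) (c : 'I_K -> 'M[C]_N).
Hypothesis cH : forall p, adj (c p) = c p.
Hypothesis cC : forall p q, c p *m c q + c q *m c p = (2 * (p == q)%:R)%:M.

Definition cl (u : 'cV[C]_K) : 'M[C]_N := \sum_p u p 0 *: c p.

Definition quad (M : 'M[C]_K) : 'M[C]_N := \sum_p \sum_q M p q *: (c p *m c q).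

Implicit Types (u : 'cV[C]_K) (F v : 'cV[C]_N) (M : 'M[C]_K).

Lemma clD u (v : 'cV[C]_K) : cl (u + v) = cl u + cl v.
Proof. by rewrite /cl -big_split; apply: eq_bigr => p _; rewrite mxE scalerDl. Qed.

Lemma clZ a u : cl (a *: u) = a *: cl u.
Proof. by rewrite /cl scaler_sumr; apply: eq_bigr => p _; rewrite mxE scalerA. Qed.

Lemma cl_sum (I : Type) (r : seq I) (P : pred I) (F : I -> 'cV[C]_K) :
  cl (\sum_(i <- r | P i) F i) = \sum_(i <- r | P i) cl (F i).
Proof.
elim/big_rec2: _ => [|i x y _ <-]; last by rewrite clD.
by rewrite /cl big1 // => p _; rewrite mxE scale0r.
Qed.

Lemma adj_cl u : adj (cl u) = cl (conjv u).
Proof. by rewrite /cl adj_sum; apply: eq_bigr => p _; rewrite adjZ cH mxE. Qed.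

Lemma cl_anticomm u (v : 'cV[C]_K) :
  cl u *m cl v + cl v *m cl u = (2 * \sum_p u p 0 * v p 0)%:M.
Proof.
have -> : cl u *m cl v = \sum_p \sum_q (u p 0 * v q 0) *: (c p *m c q).
  rewrite /cl mulmx_suml; apply: eq_bigr => p _; rewrite mulmx_sumr; apply: eq_bigr => q _.
  by rewrite -scalemxAr -scalemxAl scalerA mulrC.
have -> : cl v *m cl u = \sum_p \sum_q (u p 0 * v q 0) *: (c q *m c p).
  rewrite exchange_big /cl mulmx_suml; apply: eq_bigr => q _; rewrite mulmx_sumr.
  by apply: eq_bigr => p _; rewrite -scalemxAr -scalemxAl scalerA.
rewrite -big_split mulr_sumr raddf_sum /=; apply: eq_bigr => p _.
rewrite -big_split (bigD1 p) //= -scalerDr cC eqxx mulr1 scale_scalar_mx.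
rewrite big1 ?addr0 => [|q ne]; first by rewrite mulrC.
by rewrite -scalerDr cC eq_sym (negPf ne) mulr0 scale_scalar_mx mulr0 raddf0.
Qed.

Lemma cl_anticomm_c u a : u a 0 = 0 -> cl u *m c a = - (c a *m cl u).
Proof.
move=> ua; apply/eqP; rewrite -addr_eq0 /cl mulmx_suml mulmx_sumr -big_split big1 //= => p _.
rewrite -scalemxAl -scalemxAr -scalerDr cC.
have [->|ne] := eqVneq p a; first by rewrite ua scale0r.
by rewrite mulr0 raddf0 scaler0.
Qed.

Lemma sum_conj u : \sum_p (conjv u) p 0 * u p 0 = (ns u)%:C.
Proof.
rewrite nsE rmorph_sum; apply: eq_bigr => p _; rewrite mxE; case: (u p 0) => x y /=.
by apply: complexP => /=; ring.
Qed.

Lemma ns_c p F : ns (c p *m F) = ns F.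
Proof.
rewrite /ns ip_adj cH mulmxA.
have -> : c p *m c p = 1%:M; last by rewrite mul1mx.
have := cC p p; rewrite eqxx mulr1 -mulr2n -scaler_nat -scalemx1 => H.
by apply: (scalerI (a := 2 : C)) => //; rewrite pnatr_eq0.
Qed.

(** By the anticommutator of [cl u] with its adjoint, the squared norms for [u] and for its
    conjugate add up to exactly the right-hand side; the second one is dropped. *)
Lemma ns_cl_le u F : ns (cl u *m F) <= 2 * ns u * ns F.
Proof.
have := cl_anticomm (conjv u) u; rewrite sum_conj => H.
have : ns (cl u *m F) + ns (cl (conjv u) *m F) = 2 * ns u * ns F.
  rewrite /ns !ip_adj !adj_cl -ipDr !mulmxA -mulmxDl.
  have -> : conjv (conjv u) = u by apply/matrixP => i j; rewrite !mxE conjcK.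
  rewrite H mul_scalar_mx -ipZr; congr ip; congr (_ *: _).
  by rewrite rmorphM rmorph_nat.
by move<-; rewrite lerDl ns_ge0.
Qed.

Lemma quadD M1 M2 : quad (M1 + M2) = quad M1 + quad M2.
Proof.
rewrite /quad -big_split; apply: eq_bigr => p _; rewrite -big_split; apply: eq_bigr => q _.
by rewrite mxE scalerDl.
Qed.

Lemma adj_quad M : adj M = M -> adj (quad M) = quad M.
Proof.
move=> hM; rewrite /quad adj_sum exchange_big /=; apply: eq_bigr => p _.
rewrite adj_sum; apply: eq_bigr => q _.
by rewrite adjZ adjM !cH -{2}hM !mxE.
Qed.

(** Moving [c r] through a product of two generators leaves two contractions, each with coefficient
    2. Antisymmetry of [M] makes both sums equal, whence the 4. *)
Lemma quad_comm_c M r : M^T = - M ->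
  quad M *m c r = c r *m quad M + 4 *: \sum_p M p r *: c p.
Proof.
move=> hM.
have E p q : c p *m c q *m c r =
    c r *m (c p *m c q) + (2 * (q == r)%:R) *: c p - (2 * (p == r)%:R) *: c q.
  have h1 : c q *m c r = (2 * (q == r)%:R)%:M - c r *m c q by rewrite -cC addrK.
  have h2 : c p *m c r = (2 * (p == r)%:R)%:M - c r *m c p by rewrite -cC addrK.
  rewrite -mulmxA h1 mulmxBr mul_mx_scalar (mulmxA (c p) (c r)) h2 mulmxBl mul_scalar_mx.
  rewrite -(mulmxA (c r)).
  by rewrite opprB addrCA addrA.
have -> : quad M *m c r = c r *m quad M + (\sum_p \sum_q (M p q * (2 * (q == r)%:R)) *: c p
     - \sum_p \sum_q (M p q * (2 * (p == r)%:R)) *: c q).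
  rewrite /quad mulmx_suml mulmx_sumr -sumrB -big_split /=; apply: eq_bigr => p _.
  rewrite mulmx_suml mulmx_sumr -sumrB -big_split /=; apply: eq_bigr => q _.
  by rewrite -scalemxAl E -scalemxAr !scalerDr scalerN !scalerA addrA.
congr (_ + _).
have -> : \sum_p \sum_q (M p q * (2 * (q == r)%:R)) *: c p = 2 *: \sum_p M p r *: c p.
  rewrite scaler_sumr; apply: eq_bigr => p _; rewrite (bigD1 r) //= eqxx mulr1 big1 ?addr0.
    by rewrite scalerA mulrC.
  by move=> q /negPf ->; rewrite !mulr0 scale0r.
have -> : \sum_p \sum_q (M p q * (2 * (p == r)%:R)) *: c q = - (2 *: \sum_p M p r *: c p).
  rewrite (bigD1 r) //= eqxx mulr1 [X in _ + X]big1 ?addr0.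
    rewrite scaler_sumr -sumrN; apply: eq_bigr => q _.
    have -> : M r q = - M q r by have := congr1 (fun B : 'M_K => B q r) hM; rewrite !mxE.
    by rewrite mulNr scaleNr scalerA mulrC.
  by move=> p /negPf ne; rewrite big1 // => q _; rewrite ne !mulr0 scale0r.
by rewrite opprK -scalerDl -natrD.
Qed.

(** The commutator with a quadratic form acts linearly on one-particle coefficients, so conjugating
    operators reduces to linear algebra in dimension [K]. *)
Lemma quad_comm_cl M u : M^T = - M ->
  quad M *m cl u = cl u *m quad M + 4 *: cl (M *m u).
Proof.
move=> hM.
have -> : quad M *m cl u = \sum_p u p 0 *: (quad M *m c p).
  by rewrite /cl mulmx_sumr; apply: eq_bigr => p _; rewrite -scalemxAr.
under eq_bigr => p _ do rewrite (quad_comm_c p hM) scalerDr scalemxAl.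
rewrite big_split /=; congr (_ + _); first by rewrite /cl mulmx_suml.
rewrite /cl scaler_sumr.
under eq_bigr => p _ do rewrite scaler_sumr scaler_sumr.
rewrite exchange_big /=; apply: eq_bigr => q _; rewrite mxE scaler_suml scaler_sumr.
by apply: eq_bigr => p _; rewrite !scalerA; congr (_ *: _); ring.
Qed.

(** * Normal modes and vacuum of a quadratic form *)

Section Modes.
Variables (M V : 'M[C]_K) (e : 'I_K -> R).
Hypothesis MT : M^T = - M.
Hypothesis sd : spectral_decomp M V e.

Let Mh : adj M = M.
Proof. by rewrite (sd_fmx sd) adj_fmx. Qed.

(** A Hermitian antisymmetric matrix is purely imaginary, so conjugation negates the eigenvalue. The
    choice made here always has eigenvalue -|e_k|, which makes [cl (low_mode k)] a lowering
    operator. *)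
Definition low_mode k : 'cV[C]_K := if 0 < e k then conjv (evec V k) else evec V k.

Lemma low_mode_eigen k : M *m low_mode k = (- `|e k|)%:C *: low_mode k.
Proof.
have E := evec_eigen sd k; rewrite /low_mode; case: ltrP => ek.
  rewrite ger0_norm ?ltW //.
  have Mc : conjv M = - M by rewrite -MT; apply/matrixP => i j; rewrite -[in RHS]Mh !mxE.
  have -> : M = - conjv M by rewrite Mc opprK.
  rewrite mulNmx /conjv -map_mxM E map_mxZ rmorphN scaleNr; congr (- (_ *: _)).
  by rewrite /= oppr0.
by rewrite ler0_norm // opprK.
Qed.

(** Row [a] of the eigenvalue equation says that -|e_k| times this entry is zero. *)
Lemma low_mode_supp a k : (forall q, M a q = 0) -> e k != 0 -> low_mode k a 0 = 0.
Proof.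
move=> Ma ek; have := congr1 (fun B : 'cV_K => B a 0) (low_mode_eigen k).
rewrite !mxE big1 => [/esym/eqP|q _]; last by rewrite Ma mul0r.
rewrite mulf_eq0 => /orP [|/eqP //]; rewrite fmorph_eq0 oppr_eq0 normr_eq0.
by rewrite (negPf ek).
Qed.

(* The bilinear form of two negative eigenvectors of the antisymmetric M
   satisfies (|e_k| + |e_l|) w_k^T w_l = 0. *)
Lemma low_mode_anticomm k l : e k != 0 ->
  cl (low_mode k) *m cl (low_mode l) = - (cl (low_mode l) *m cl (low_mode k)).
Proof.
move=> ek; apply/eqP; rewrite -addr_eq0 cl_anticomm.
set S := \sum_p _; suff -> : S = 0 by rewrite mulr0 raddf0.
have SE : ((low_mode k)^T *m low_mode l) 0 0 = S.
  by rewrite mxE; apply: eq_bigr => p _; rewrite mxE.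
have h1 : ((low_mode k)^T *m (M *m low_mode l)) 0 0 = (- `|e l|)%:C * S.
  by rewrite low_mode_eigen -scalemxAr mxE SE.
have h2 : ((low_mode k)^T *m (M *m low_mode l)) 0 0 = `|e k|%:C * S.
  rewrite mulmxA -[M]trmxK MT -trmx_mul mulNmx low_mode_eigen -scaleNr -rmorphN opprK.
  by rewrite linearZ /= -scalemxAl mxE SE.
have : (`|e k| + `|e l|)%:C * S = 0.
  rewrite rmorphD mulrDl -h2 h1 rmorphN mulNr addNr //.
move/eqP; rewrite mulf_eq0 fmorph_eq0 => /orP [|/eqP //].
by rewrite paddr_eq0 // normr_eq0 (negPf ek).
Qed.

Lemma trace_modes : \sum_k e k = 0.
Proof.
have t0 : \tr M = 0.
  have : \tr M = - \tr M by rewrite -{1}mxtrace_tr MT raddfN.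
  by move/eqP; rewrite -addr_eq0 -mulr2n mulrn_eq0 => /eqP.
have : \tr M = (\sum_k e k)%:C.
  rewrite {1}(sd_E sd) mxtrace_mulC mulmxA (sd_r sd) mul1mx rmorph_sum.
  by apply: eq_bigr => k _; rewrite !mxE eqxx mulr1n.
by rewrite t0 => /esym/eqP; rewrite fmorph_eq0 => /eqP.
Qed.

(** Normal ordering: expand [M] in its eigenprojectors and, where e_k is nonpositive, exchange the
    two factors at the cost of the constant 2 e_k. The constants e_k - |e_k| sum to minus the sum of
    the |e_k|, because the trace of [M] is zero. *)
Lemma quad_modes : quad M =
  \sum_k `|e k|%:C *: (adj (cl (low_mode k)) *m cl (low_mode k)) - ((\sum_k `|e k|)%:C)%:M.
Proof.
have E : quad M = \sum_k (e k)%:C *: (cl (evec V k) *m cl (conjv (evec V k))).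
  rewrite /cl.
  under [RHS]eq_bigr => k _ do rewrite mulmx_suml scaler_sumr.
  rewrite exchange_big; apply: eq_bigr => p _.
  under [RHS]eq_bigr => k _ do rewrite mulmx_sumr scaler_sumr.
  rewrite exchange_big; apply: eq_bigr => q _.
  under [RHS]eq_bigr => k _ do rewrite -scalemxAl -scalemxAr !scalerA.
  rewrite -scaler_suml; congr (_ *: _).
  rewrite {1}(sd_E sd) /dmx mul_mx_diag mxE; apply: eq_bigr => k _.
  by rewrite !mxE conjcK; ring.
have T k : (e k)%:C *: (cl (evec V k) *m cl (conjv (evec V k))) =
    `|e k|%:C *: (adj (cl (low_mode k)) *m cl (low_mode k)) + (e k - `|e k|)%:C%:M.
  have cK u : conjv (conjv u) = u :> 'cV[C]_K by apply/matrixP => i j; rewrite !mxE conjcK.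
  rewrite adj_cl /low_mode; case: ltrP => ek.
    by rewrite ger0_norm ?ltW // cK subrr raddf0 addr0.
  rewrite ler0_norm // opprK.
  have := cl_anticomm (conjv (evec V k)) (evec V k).
  rewrite sum_conj (ns_evec sd) mulr1 addrC => /eqP.
  rewrite eq_sym -subr_eq eq_sym => /eqP ->.
  rewrite scalerBr scale_scalar_mx rmorphN scaleNr addrC; congr (_ + _%:M).
  by rewrite rmorphD /= mulr_natr mulr2n.
rewrite E (eq_bigr _ (fun k _ => T k)) big_split /=; congr (_ + _).
rewrite -raddf_sum -raddfN /= -rmorph_sum -rmorphN sumrB trace_modes sub0r.
by [].
Qed.

Lemma ip_quad v : ip v (quad M *m v) =
  \sum_k `|e k| * ns (cl (low_mode k) *m v) - (\sum_k `|e k|) * ns v.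
Proof.
rewrite quad_modes mulmxBl ipDr ipNr mul_scalar_mx ipZr mulmx_suml ip_sumr; congr (_ - _).
by apply: eq_bigr => k _; rewrite -scalemxAl ipZr /ns ip_adj mulmxA.
Qed.

Lemma ip_quad_ge v : - (\sum_k `|e k|) * ns v <= ip v (quad M *m v).
Proof.
by rewrite ip_quad mulNr lerDr sumr_ge0 // => k _; rewrite mulr_ge0 ?ns_ge0.
Qed.

(* Fermionic vacuum: apply the mutually anticommuting lowering operators one
   after the other, skipping those that already annihilate the vector. *)
Lemma vacuum (P : 'cV[C]_N -> Prop) v :
  (forall k w, e k != 0 -> P w -> P (cl (low_mode k) *m w)) -> v != 0 -> P v ->
  exists w, [/\ w != 0, P w & ip w (quad M *m w) = - (\sum_k `|e k|) * ns w].
Proof.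
move=> hP v0 Pv; pose s := [seq k <- enum 'I_K | e k != 0].
have [|||//|w [w0 Pw kw]] := @joint_kernel _ _ (fun k => cl (low_mode k)) P s v.
- by move=> k l; rewrite mem_filter => /andP [ek _] _; exact: low_mode_anticomm.
- by move=> k w; rewrite mem_filter => /andP [ek _]; exact: hP.
- exact: v0.
exists w; split=> //; rewrite ip_quad big1 ?sub0r ?mulNr // => k _.
have [->|ek] := eqVneq (e k) 0; first by rewrite normr0 mul0r.
have ks : k \in s by rewrite mem_filter ek mem_enum.
by rewrite kw // /ns ip0r mulr0.
Qed.

End Modes.
End Clifford.

(** * The bath and the impurity coupling *)

Section Model.
Variable R : realType.
Local Notation C := R[i].
Local Open Scope complex_scope.
Variables (K N : nat) (c : 'I_K -> 'M[C]_N).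
Hypothesis cH : forall p, adj (c p) = c p.
Hypothesis cC : forall p q, c p *m c q + c q *m c p = (2 * (p == q)%:R)%:M.
Variables (M : 'M[C]_K) (A : pred 'I_K) (t1 : R).
Hypothesis MT : M^T = - M.
Hypothesis Mh : adj M = M.
Hypothesis Mle : forall u : 'cV[C]_K, ns (M *m u) <= ns u.

(** The predicate [A] marks the impurity indices; its complement is the bath. *)
Definition bath_proj : 'M[C]_K := dmx (fun k => (~~ A k)%:R).
Definition bath_mx : 'M[C]_K := bath_proj *m M *m bath_proj.
Local Notation MB := bath_mx.

Lemma bath_mxE p q : MB p q = if A p || A q then 0 else M p q.
Proof.
rewrite /MB /bath_proj /dmx mul_mx_diag mxE mul_diag_mx !mxE.
by case: (A p); case: (A q); rewrite /= ?mul0r ?mulr0 ?mul1r ?mulr1.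
Qed.

Lemma M_antisym p q : M q p = - M p q.
Proof. by have := congr1 (fun B : 'M_K => B p q) MT; rewrite !mxE. Qed.

Lemma bath_mxT : MB^T = - MB.
Proof.
apply/matrixP => p q; rewrite [LHS]mxE [RHS]mxE !bath_mxE orbC.
by case: ifP => _; rewrite ?oppr0 // M_antisym.
Qed.

Lemma coupling_mxE p q : (M - MB) p q = if A p || A q then M p q else 0.
Proof.
by rewrite mxE [X in _ + X]mxE bath_mxE; case: ifP; rewrite ?subr0 ?subrr.
Qed.

Lemma adj_bath_mx : adj MB = MB.
Proof. by rewrite /bath_mx !adjM adj_dmx Mh mulmxA. Qed.

Lemma ns_bath_proj u : ns (bath_proj *m u) <= ns u.
Proof.
rewrite !nsE; apply: ler_sum => k _; rewrite dmxE ReM ImM /=; case: (A k) => /=.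
  by rewrite !mul0r !addr0 subr0 expr0n /= addr0 addr_ge0 ?sqr_ge0.
by rewrite !mul0r !mul1r subr0 addr0.
Qed.

Lemma bath_mx_le u : ns (MB *m u) <= ns u.
Proof.
rewrite /bath_mx -!mulmxA; apply: le_trans (ns_bath_proj _) _.
by apply: le_trans (Mle _) _; exact: ns_bath_proj.
Qed.

(* A bath index q pairs with a in both orders, and M_aq c_a c_q = M_qa c_q c_a:
   hence the factor 2. *)
Definition coupling (a : 'I_K) : 'cV[C]_K := \col_q (if A q then M a q else 2 * M a q).

(** Up to sign, row [a] of [M] is the image of a unit vector under a contraction, so its squared
    norm is at most 1; doubling some entries costs at most a factor 4. *)
Lemma ns_coupling a : ns (coupling a) <= 4.
Proof.
have h : ns (M *m delta_mx a (0 : 'I_1)) <= 1.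
  apply: le_trans (Mle _) _; rewrite nsE (bigD1 a) //= big1 => [|q ne].
    by rewrite !mxE !eqxx /= expr1n expr0n addr0 addr0.
  by rewrite !mxE (negPf ne) /= expr0n addr0.
have -> : 4 = 4 * 1 :> R by rewrite mulr1.
apply: le_trans (ler_wpM2l _ h) => //.
rewrite !nsE mulr_sumr; apply: ler_sum => q _.
rewrite -colE !mxE M_antisym; case: (M q a) => x y; case: (A q) => /=.
  rewrite !sqrrN.
  have := sqr_ge0 x; have := sqr_ge0 y; lra.
rewrite [X in X <= _](_ : _ = 4 * (x ^+ 2 + y ^+ 2)) //; ring.
Qed.

(** Terms with a bath index first and an impurity index second are reordered and merged with their
    mirror images. What remains is one product per impurity index, which is why later bounds scale
    with the impurity size and not with [K]. *)
Lemma quad_coupling : quad c (M - MB) = \sum_(a | A a) c a *m cl c (coupling a).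
Proof.
have -> : quad c (M - MB) = \sum_(p | A p) \sum_q M p q *: (c p *m c q)
    + \sum_(p | ~~ A p) \sum_(q | A q) M p q *: (c p *m c q).
  rewrite /quad (bigID A) /=; congr (_ + _); apply: eq_bigr => p Ap.
    by apply: eq_bigr => q _; rewrite coupling_mxE Ap.
  rewrite (bigID A) /= [X in _ + X]big1 ?addr0 => [|q Aq].
    by apply: eq_bigr => q Aq; rewrite coupling_mxE Aq orbT.
  by rewrite coupling_mxE (negPf Ap) (negPf Aq) scale0r.
rewrite [X in _ + X]exchange_big /= -big_split /=; apply: eq_bigr => a Aa.
rewrite /cl mulmx_sumr (bigID A) /= [in RHS](bigID A) /= -addrA; congr (_ + _).
  by apply: eq_bigr => q Aq; rewrite !mxE Aq scalemxAr.
rewrite -big_split; apply: eq_bigr => q Aq; rewrite !mxE (negPf Aq) -scalemxAr /=.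
have qa : (q == a) = false by apply/negbTE; apply: contraNneq Aq => ->.
have -> : c q *m c a = - (c a *m c q).
  by apply/eqP; rewrite -addr_eq0 cC qa mulr0 raddf0.
by rewrite (M_antisym a q) scalerN scaleNr opprK -scalerDl mulrDl mul1r.
Qed.

Definition H0m : 'M[C]_N := ((t1 / 4)%:C)%:M + (4^-1)%:C *: quad c M.
Definition Xm : 'M[C]_N := ((t1 / 4)%:C)%:M + (4^-1)%:C *: quad c MB.
Definition Wm : 'M[C]_N := (4^-1)%:C *: quad c (M - MB).

Lemma H0mE : H0m = Xm + Wm.
Proof.
by rewrite /H0m /Xm /Wm -addrA -scalerDr -quadD [MB + _]addrC subrK.
Qed.

Lemma adj_H0m : adj H0m = H0m.
Proof.
by rewrite /H0m adjD adjZ adj_scalar (adj_quad cH Mh) !conj_real.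
Qed.

Lemma adj_Xm : adj Xm = Xm.
Proof.
by rewrite /Xm adjD adjZ adj_scalar (adj_quad cH adj_bath_mx) !conj_real.
Qed.

Lemma inv4K (V : lmodType C) (v : V) : (4^-1 : R)%:C *: (4 *: v) = v.
Proof.
have -> : 4 = (4 : R)%:C by rewrite rmorph_nat.
by rewrite scalerA -rmorphM mulVf ?rmorph1 ?scale1r // pnatr_eq0.
Qed.

(** The prefactor 1/4 cancels the 4 of the commutator, so [Xm] acts on coefficients exactly by the
    bath matrix. *)
Lemma Xm_comm_cl u : Xm *m cl c u = cl c u *m Xm + cl c (MB *m u).
Proof.
rewrite /Xm mulmxDl mulmxDr mul_scalar_mx mul_mx_scalar -addrA; congr (_ + _).
by rewrite -scalemxAl (quad_comm_cl cC u bath_mxT) scalerDr inv4K scalemxAr.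
Qed.

Lemma Xm_comm_c a : A a -> Xm *m c a = c a *m Xm.
Proof.
move=> Aa; rewrite /Xm mulmxDl mulmxDr mul_scalar_mx mul_mx_scalar; congr (_ + _).
rewrite -scalemxAl (quad_comm_c cC a bath_mxT) big1 ?scaler0 ?addr0 ?scalemxAr // => p _.
by rewrite bath_mxE Aa orbT scale0r.
Qed.

(** * Evolution under the bath Hamiltonian, and the ground energy *)

Section Heisenberg.
Variables (U : 'M[C]_N) (d : 'I_N -> R).
Hypothesis sdX : spectral_decomp Xm U d.
Local Notation E := (prop U d).

(** Expand [u] in the eigenbasis of the bath matrix: each eigenvector gives an operator shifting
    [Xm] by e_k, hence a factor e^{t e_k}. So [y] is e^{tB} u with B the bath matrix, and |e_k| <= 1
    gives the bound. *)
Lemma heisenberg_cl u t : exists y, E t *m cl c u = cl c y *m E t /\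
  ns y <= expR (2 * `|t|) * ns u.
Proof.
have [V [e sdB]] := hermitian_spectral adj_bath_mx.
have e1 k : `|e k| <= 1.
  have := bath_mx_le (evec V k); rewrite (evec_eigen sdB) nsZ (ns_evec sdB) mulr1.
  by rewrite -real_normK ?num_real // expr_le1.
exists (prop V e t *m u); split; last first.
  rewrite /prop (ns_fmx sdB); apply: (ip_fmx_le sdB) => k.
  rewrite -expRM_natl ler_expR ler_wpM2l //.
  apply: le_trans (ler_norm _) _; rewrite normrM -[leRHS]mulr1.
  by rewrite ler_wpM2l.
have uE : u = \sum_k (V *m u) k 0 *: evec V k.
  have {1}-> : u = adj V *m (V *m u) by rewrite mulmxA (sd_l sdB) mul1mx.
  apply/matrixP => i j; rewrite summxE mxE; apply: eq_bigr => k _.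
  by rewrite ord1 !mxE mulrC.
have yE : prop V e t *m u = \sum_k (V *m u) k 0 *: ((expR (t * e k))%:C *: evec V k).
  rewrite {1}uE mulmx_sumr; apply: eq_bigr => k _.
  by rewrite -scalemxAr /prop (fmx_evec sdB).
rewrite yE {1}uE !cl_sum mulmx_sumr mulmx_suml; apply: eq_bigr => k _.
rewrite !clZ -scalemxAr -!scalemxAl; congr (_ *: _).
apply: (prop_intertwine sdX).
by rewrite Xm_comm_cl (evec_eigen sdB) clZ.
Qed.

Local Notation m := (\sum_(a | A a) 1 : R).

(** [Wt] is e^{tX} W e^{-tX}. The impurity generators commute with X and pass through unchanged, so
    only the coupling vectors evolve, with squared norm at most 4 e^{2|t|}. *)
Lemma heisenberg_W t : exists Wt, E t *m Wm = Wt *m E t /\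
  forall F, `|ip F (Wt *m F)| <= 3 / 4 * m * expR `|t| * ns F.
Proof.
have /fin_all_exists [y hy] : forall a, exists y, E t *m cl c (coupling a) = cl c y *m E t /\
  ns y <= expR (2 * `|t|) * ns (coupling a) by move=> a; exact: heisenberg_cl.
exists ((4^-1)%:C *: \sum_(a | A a) c a *m cl c (y a)); split.
  rewrite /Wm quad_coupling -scalemxAr -scalemxAl; congr (_ *: _).
  rewrite mulmx_sumr mulmx_suml; apply: eq_bigr => a Aa.
  rewrite mulmxA (prop_comm sdX t (Xm_comm_c Aa)) -(mulmxA (c a) (E t)) (hy a).1.
  by rewrite mulmxA.
move=> F; rewrite -scalemxAl ipZr normrM ger0_norm ?invr_ge0 //.
have -> : 3 / 4 * m * expR `|t| * ns F = 4^-1 * \sum_(a | A a) (3 * expR `|t| * ns F).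
  by rewrite !mulr_sumr !mulr_suml; apply: eq_bigr => a _; field.
rewrite ler_wpM2l ?invr_ge0 // mulmx_suml ip_sumr.
apply: le_trans (ler_norm_sum _ _ _) _; apply: ler_sum => a Aa.
set x := expR `|t|; have x0 : 0 < x by exact: expR_gt0.
rewrite -mulmxA -{1}(cH a) -ip_adj.
(* The weight [2 * x] gives x + 2x = 3x; it is a rational substitute for the optimal weight, which
   would give 2 sqrt(2) x. *)
apply: le_trans (ip_amgm _ _ (_ : 0 < 2 * x)) _; first by rewrite mulr_gt0.
rewrite (ns_c cH cC).
have h1 : ns (cl c (y a) *m F) <= 8 * x ^+ 2 * ns F.
  apply: le_trans (ns_cl_le cH cC _ _) _; rewrite ler_wpM2r ?ns_ge0 //.
  have -> : 8 * x ^+ 2 = 2 * (x ^+ 2 * 4) by ring.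
  rewrite ler_wpM2l //; apply: le_trans (hy a).2 _.
  by rewrite /x -expRM_natl ler_wpM2l ?expR_ge0 // ns_coupling.
have -> : 3 * x * ns F = 2 * x / 2 * ns F + 8 * x ^+ 2 * ns F / (2 * (2 * x)).
  by field; rewrite gt_eqF.
by rewrite lerD2l ler_wpM2r // invr_ge0 !mulr_ge0 // ltW.
Qed.

Lemma Wm_bound F : `|ip F (Wm *m F)| <= 3 / 4 * m * ns F.
Proof.
have [Wt [h1 h2]] := heisenberg_W 0; have := h2 F.
by rewrite normr0 expR0 mulr1; move: h1; rewrite (prop0 sdX) mul1mx mulmx1 => ->.
Qed.

Variables (Hi : 'M[C]_N).
Hypothesis Hih : adj Hi = Hi.
Hypothesis Hi_comm : forall Z, (forall a, A a -> Z *m c a = c a *m Z) -> Z *m Hi = Hi *m Z.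
Hypothesis Hi_anticomm : forall Z, (forall a, A a -> Z *m c a = - (c a *m Z)) ->
  Z *m Hi = Hi *m Z.
Variables (V : 'M[C]_K) (e : 'I_K -> R).
Hypothesis sdM : spectral_decomp M V e.
Hypothesis t1_le : t1 <= \sum_k `|e k|.
Variables (psi : 'cV[C]_N) (E0 : R).
Hypothesis psi0 : psi != 0.
Hypothesis E0_le : forall v, E0 * ns v <= ip v ((H0m + Hi) *m v).

Lemma Xm_comm_Hi : Xm *m Hi = Hi *m Xm.
Proof. by apply: Hi_comm => a; exact: Xm_comm_c. Qed.

Lemma ip_Xm v : ip v (Xm *m v) = t1 / 4 * ns v + 4^-1 * ip v (quad c MB *m v).
Proof. by rewrite /Xm mulmxDl ipDr mul_scalar_mx ipZr -scalemxAl ipZr. Qed.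

Lemma ip_H0m v : ip v (H0m *m v) = t1 / 4 * ns v + 4^-1 * ip v (quad c M *m v).
Proof. by rewrite /H0m mulmxDl ipDr mul_scalar_mx ipZr -scalemxAl ipZr. Qed.

Lemma min_eigen (B : 'M[C]_N) : adj B = B ->
  exists l : R, (forall v : 'cV[C]_N, l * ns v <= ip v (B *m v)) /\
    exists2 v : 'cV[C]_N, v != 0 & B *m v = l%:C *: v.
Proof.
move=> hB; have [V' [f sdf]] := hermitian_spectral hB.
(* A nonzero vector supplies an index, so the minimum is over a nonempty family of eigenvalues. *)
have [i0 _] : exists i, psi i 0 != 0.
  apply/existsP; apply: contraNT psi0; rewrite negb_exists => /forallP h.
  by apply/eqP/matrixP => i j; rewrite ord1 mxE; apply/eqP; rewrite -[_ == _]negbK.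
have [i _ hi] := @arg_minP _ _ _ i0 xpredT f isT.
exists (f i); split; first by move=> v; apply: (ip_sd_ge sdf) => k; exact: hi.
by exists (evec V' i); [exact: (evec_neq0 sdf) | exact: (evec_eigen sdf)].
Qed.

(** Two trial states are used, and each pays 3/4 m for [Wm]: the vacuum of H0 bounds the lowest
    energy of [Xm], and a bath vacuum inside the lowest eigenspace of [Hi] bounds [E0]. *)
Lemma ground_energy_shift : exists l : R, (forall v : 'cV[C]_N, l * ns v <= ip v (Hi *m v)) /\
  E0 - l <= 3 / 2 * m.
Proof.
have [l [hl [v0 v00 Ev0]]] := min_eigen Hih; exists l; split=> //.
have [VB [eB sdB]] := hermitian_spectral adj_bath_mx.
(* This is the vacuum energy of [Xm]. *)
pose x := (t1 - \sum_k `|eB k|) / 4.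
have hx v : x * ns v <= ip v (Xm *m v).
  rewrite ip_Xm; have := ip_quad_ge cH cC bath_mxT sdB v; rewrite /x; lra.
have x_le : x <= 3 / 4 * m.
  have [//|Om [Om0 _ hOm]] := @vacuum _ _ _ c cH cC M V e MT sdM (fun=> True) psi _ psi0 I.
  have nOm : 0 < ns Om by rewrite ns_gt0.
  have h1 : ip Om (H0m *m Om) <= 0.
    rewrite ip_H0m hOm.
    have -> : t1 / 4 * ns Om + 4^-1 * (- (\sum_k `|e k|) * ns Om)
      = (t1 - \sum_k `|e k|) * (ns Om / 4) by field.
    by rewrite mulr_le0_ge0 ?divr_ge0 ?subr_le0 // ltW.
  have := hx Om; have := Wm_bound Om; rewrite ler_norml => /andP [h2 _] h3.
  move: h1; rewrite H0mE mulmxDl ipDr => h1.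
  rewrite -(ler_pM2r nOm); lra.
have [|v [v_0 Ev hv]] := @vacuum _ _ _ c cH cC MB VB eB bath_mxT sdB
    (fun w => Hi *m w = l%:C *: w) v0 _ v00 Ev0.
(* Bath modes of nonzero energy vanish on impurity indices, so they anticommute with the impurity
   generators and commute with [Hi]; filling them stays in the [l]-eigenspace. *)
- move=> k w ek Ew; rewrite mulmxA -Hi_anticomm; last first.
    move=> a Aa; apply: (cl_anticomm_c cC); apply: (low_mode_supp bath_mxT sdB) => // q.
    by rewrite bath_mxE Aa.
  by rewrite -mulmxA Ew scalemxAr.
have nv : 0 < ns v by rewrite ns_gt0.
have := E0_le v; rewrite H0mE (mulmxDl _ Hi) (mulmxDl Xm) !ipDr Ev ipZr ip_Xm hv -/(ns v).
have := Wm_bound v; rewrite ler_norml => /andP [_ h2] h1.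
rewrite -(ler_pM2r nv).
have : x * ns v <= 3 / 4 * m * ns v by rewrite ler_pM2r.
rewrite /x; lra.
Qed.

End Heisenberg.
End Model.

(** * Jordan-Wigner representation *)

Section BinaryDigits.
Local Open Scope nat_scope.

Lemma divn_add_pow_low y j k : k <= j -> (y + 2 ^ j) %/ 2 ^ k = y %/ 2 ^ k + 2 ^ (j - k).
Proof.
move=> kj; rewrite -{1}(subnK kj) expnD divnDr ?dvdn_mull //.
by rewrite mulnK ?expn_gt0.
Qed.

(** Bit [j] is clear, so the addition produces no carry into higher bits. *)
Lemma divn_add_pow_high y j k : ~~ occ y j -> j < k -> (y + 2 ^ j) %/ 2 ^ k = y %/ 2 ^ k.
Proof.
rewrite /occ => yj jk; have -> : 2 ^ k = 2 ^ j * (2 * 2 ^ (k - j.+1)).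
  by rewrite -expnS -expnD; congr (2 ^ _); rewrite subnSK // subnKC // ltnW.
rewrite !divnMA divn_add_pow_low // subnn expn0; congr (_ %/ _).
by rewrite addn1 !divn2 -[(_).+1./2]/(uphalf _) uphalf_half (negPf yj) add0n.
Qed.

Lemma occ_add_pow y j k : ~~ occ y j -> occ (y + 2 ^ j) k = (k == j) || occ y k.
Proof.
move=> yj; case: (ltngtP k j) => [kj|jk|->] /=.
- rewrite /occ divn_add_pow_low ?(ltnW kj) // oddD oddX /=.
  by rewrite subn_eq0 leqNgt kj /= addbF.
- by rewrite /occ divn_add_pow_high.
- by rewrite /occ divn_add_pow_low // subnn oddD; move: yj; rewrite /occ => /negPf ->.
Qed.

Lemma occ_ge x j : occ x j -> 2 ^ j <= x.
Proof. by rewrite leqNgt; apply: contraL => h; rewrite /occ divn_small. Qed.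

Lemma occ_sub_pow_self x j : occ x j -> ~~ occ (x - 2 ^ j) j.
Proof.
move=> xj; have := xj; rewrite -{1}(subnK (occ_ge xj)) /occ divn_add_pow_low // subnn oddD.
by rewrite addbT.
Qed.

Lemma occ_sub_pow x j k : occ x j -> occ (x - 2 ^ j) k = (k != j) && occ x k.
Proof.
move=> xj; have h := occ_sub_pow_self xj.
have := occ_add_pow k h; rewrite subnK ?occ_ge // => ->.
by case: eqVneq => [->|//]; rewrite (negPf h).
Qed.

Definition flip (j x : nat) : nat := if occ x j then x - 2 ^ j else x + 2 ^ j.

Lemma occ_flip j x k : occ (flip j x) k = (k == j) (+) occ x k.
Proof.
rewrite /flip; case: ifP => h.
  by rewrite occ_sub_pow //; case: eqVneq => [->|]; rewrite ?h.
by rewrite occ_add_pow ?h //; case: eqVneq => [->|]; rewrite ?h.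
Qed.

Lemma flip_lt n j x : x < 2 ^ n -> j < n -> flip j x < 2 ^ n.
Proof.
move=> xn jn; rewrite /flip; case: ifP => h; first exact: leq_ltn_trans (leq_subr _ _) xn.
rewrite ltnNge; apply/negP => le.
have := divn_add_pow_high (negbT h) jn; rewrite (divn_small xn) => /eqP.
by rewrite -leqn0 leqNgt divn_gt0 ?expn_gt0 // le.
Qed.

Lemma occ_inj n x y : x < 2 ^ n -> y < 2 ^ n -> (forall j, j < n -> occ x j = occ y j) -> x = y.
Proof.
elim: n x y => [|n IH] x y; first by rewrite expn0 !ltnS !leqn0 => /eqP -> /eqP ->.
move=> xn yn h; have h0 := h 0 isT; rewrite /occ expn0 !divn1 in h0.
rewrite -(odd_double_half x) -(odd_double_half y) h0; congr (_ + _.*2).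
apply: IH; rewrite -?divn2 ?ltn_divLR // -?expnSr // => j jn.
by have := h j.+1 jn; rewrite /occ expnS !divnMA !divn2.
Qed.

End BinaryDigits.

(** * Majorana operators as phased permutations of the basis *)

Section JordanWigner.
Variable R : realType.
Local Notation C := R[i].
Local Open Scope complex_scope.
Variable n : nat.

Lemma mode_lt (p : 'I_(2 * n)) : (p %/ 2 < n)%N.
Proof. by rewrite ltn_divLR // [X in (_ < X)%N]mulnC. Qed.

Definition mode (p : 'I_(2 * n)) : 'I_n := Ordinal (mode_lt p).

Implicit Types (p q : 'I_(2 * n)) (x y : 'I_(2 ^ n)) (j k : 'I_n).

Definition flipo (j : 'I_n) (x : 'I_(2 ^ n)) : 'I_(2 ^ n) :=
  Ordinal (flip_lt (ltn_ord x) (ltn_ord j)).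

Lemma occ_flipo j x (k : nat) : occ (flipo j x) k = (k == j) (+) occ x k.
Proof. exact: occ_flip. Qed.

Lemma flipoK j : involutive (flipo j).
Proof.
move=> x; apply/val_inj/(@occ_inj n); rewrite ?ltn_ord // => k _.
by rewrite !occ_flipo addbA addbb.
Qed.

Lemma flipoC j k x : flipo j (flipo k x) = flipo k (flipo j x).
Proof.
apply/val_inj/(@occ_inj n); rewrite ?ltn_ord // => l _.
by rewrite !occ_flipo !addbA (addbC (_ == _)).
Qed.

Definition jw_sign (j : 'I_n) (x : 'I_(2 ^ n)) : C :=
  (-1) ^+ (\sum_(k < n | (k < j)%N) (occ x k : nat))%N.

(** Flipping mode [k] changes the parity of the occupations below [j] exactly when [k] lies below
    [j]. *)
Lemma jw_sign_flip j k x : jw_sign j (flipo k x) = (-1) ^+ (k < j)%N * jw_sign j x.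
Proof.
rewrite /jw_sign; case: ltnP => kj; last first.
  rewrite expr0 mul1r; congr (_ ^+ _); apply: eq_bigr => l lj.
  by rewrite occ_flipo (_ : (l == k :> nat) = false) // ltn_eqF // (leq_trans lj kj).
rewrite (bigD1 k) //= [in RHS](bigD1 k) //= !exprD mulrA; congr (_ * _).
  by rewrite occ_flipo eqxx; case: (occ x k); rewrite /= ?expr1 ?expr0 ?mulrNN ?mulr1.
congr (_ ^+ _); apply: eq_bigr => l /andP [_ /negPf lk].
by rewrite occ_flipo (_ : (l == k :> nat) = false).
Qed.

Lemma jw_sign_sq j x : jw_sign j x * jw_sign j x = 1.
Proof. by rewrite /jw_sign -exprD addnn -mul2n exprM sqrrN expr1n expr1n. Qed.

Lemma conj_jw_sign j x : conjc (jw_sign j x) = jw_sign j x.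
Proof. by rewrite /jw_sign rmorphXn rmorphN rmorph1. Qed.

(** These are the nonzero entries of the Pauli matrices X (even index) and Y (odd index) on the
    state of occupation [b]. *)
Definition jw_phase (odd_p b : bool) : C :=
  if odd_p then (if b then - (complex.Complex 0 1) else complex.Complex 0 1) else 1.

Lemma jw_phase_neg o b : jw_phase o (~~ b) * jw_phase o b = 1.
Proof.
by case: o; case: b; rewrite /= ?mulr1 //; apply: complexP => /=; ring.
Qed.

Lemma jw_phase_anti o b : jw_phase o (~~ b) * jw_phase (~~ o) b =
  - (jw_phase (~~ o) (~~ b) * jw_phase o b).
Proof. by case: o; case: b => /=; rewrite ?mul1r ?mulr1 ?opprK. Qed.

Lemma conj_jw_phase o b : conjc (jw_phase o (~~ b)) = jw_phase o b.
Proof. by case: o; case: b => //=; apply: complexP => /=; rewrite ?oppr0 ?opprK. Qed.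

Definition jw_coef (p : 'I_(2 * n)) (x : 'I_(2 ^ n)) : C :=
  jw_sign (mode p) x * jw_phase (odd p) (occ x (mode p)).

(** Each column has a single nonzero entry, so the Clifford relations become scalar identities
    between [jw_coef] values. *)
Lemma majoranaE p y x :
  majorana R p y x = if y == flipo (mode p) x then jw_coef p x else 0.
Proof.
have cE j : creat R j y x =
    if occ y j && (val x == (val y - 2 ^ j)%N) then jw_sign j y else 0.
  by rewrite /creat !mxE; case: ifP => _; rewrite ?conj_jw_sign // rmorph0.
have aE j : annih R j y x = if occ x j && (y == flipo j x) then jw_sign j x else 0.
  rewrite mxE -val_eqE /= /flip; by case: (occ x j).
have {}cE j : creat R j y x = if ~~ occ x j && (y == flipo j x) then jw_sign j x else 0.
  rewrite cE; have -> : occ y j && (val x == (val y - 2 ^ j)%N) = ~~ occ x j && (y == flipo j x).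
    apply/andP/andP => [[yj /eqP xy]|[xj /eqP ->]].
      have xj : ~~ occ x j by rewrite xy occ_sub_pow_self.
      split=> //; rewrite -val_eqE /= /flip (negPf xj) xy subnK //; exact: occ_ge.
    rewrite occ_flipo eqxx (negPf xj); split=> //=.
    by rewrite /flip (negPf xj) addnK.
  case: ifP => // /andP [xj /eqP ->].
  by rewrite jw_sign_flip ltnn expr0 mul1r.
rewrite /majorana; case: (ltnP (p %/ 2) n) => Hj; last by have := mode_lt p; rewrite ltnNge Hj.
have -> : Ordinal Hj = mode p by apply: val_inj.
rewrite /jw_coef /jw_phase; set j := mode p.
case: (odd p).
  rewrite mxE [X in _ * X]mxE [X in _ * (_ + X)]mxE aE cE.
  case: (occ x j); case: (y == _) => /=; rewrite ?subr0 ?sub0r ?mulr0 ?oppr0 ?mulr0 //.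
    by rewrite mulrC.
  by rewrite mulrNN mulrC.
rewrite mxE aE cE mulr1.
by case: (occ x j); case: (y == _) => /=; rewrite ?addr0 ?add0r.
Qed.

Lemma adj_majorana p : adj (majorana R p) = majorana R p.
Proof.
apply/matrixP => y x; rewrite 2!mxE !majoranaE.
have -> : (x == flipo (mode p) y) = (y == flipo (mode p) x).
  by apply/eqP/eqP => ->; rewrite flipoK.
case: eqP => [->|_]; last by rewrite rmorph0.
have conjM (a b : C) : conjc (a * b) = conjc a * conjc b by exact: rmorphM.
rewrite /jw_coef conjM conj_jw_sign jw_sign_flip ltnn expr0 mul1r occ_flipo eqxx.
by rewrite conj_jw_phase.
Qed.

Lemma majorana_mul p q y x : (majorana R p *m majorana R q) y x =
  if y == flipo (mode p) (flipo (mode q) x)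
  then jw_coef p (flipo (mode q) x) * jw_coef q x else 0.
Proof.
rewrite mxE (bigD1 (flipo (mode q) x)) //= big1 => [|z /negPf ne]; last first.
  by rewrite [X in _ * X]majoranaE ne mulr0.
by rewrite !majoranaE eqxx addr0; case: ifP; rewrite ?mul0r.
Qed.

Lemma jw_coef_sq p x : jw_coef p (flipo (mode p) x) * jw_coef p x = 1.
Proof.
rewrite /jw_coef jw_sign_flip ltnn expr0 mul1r occ_flipo eqxx mulrACA jw_sign_sq mul1r.
exact: jw_phase_neg.
Qed.

(** In a common mode the sign comes from X and Y anticommuting. In distinct modes exactly one of the
    two sign strings runs through the other mode. *)
Lemma jw_coef_anti p q x : p != q ->
  jw_coef p (flipo (mode q) x) * jw_coef q x = - (jw_coef q (flipo (mode p) x) * jw_coef p x).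
Proof.
move=> pq; rewrite /jw_coef !jw_sign_flip !occ_flipo.
have [E|ne] := eqVneq (mode p) (mode q).
  have opq : odd q = ~~ odd p.
    have : odd p != odd q; last by case: (odd p); case: (odd q).
    apply: contra pq => /eqP oe; apply/eqP/val_inj => /=.
    rewrite (divn_eq p 2) (divn_eq q 2) !modn2 oe.
    by have := congr1 val E => /= ->.
  rewrite -E !ltnn !eqxx opq !expr0 !mul1r !addTb mulrACA jw_phase_anti.
  by ring.
have ne' : (mode q == mode p :> nat) = false by rewrite val_eqE eq_sym (negPf ne).
have ne2 : (mode p == mode q :> nat) = false by rewrite val_eqE (negPf ne).
rewrite ne' ne2 /=.
have : (-1) ^+ (mode q < mode p)%N = - (-1) ^+ (mode p < mode q)%N :> C.
  case: ltngtP => [|_|/eqP]; rewrite ?expr1 ?expr0 ?opprK //.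
  by rewrite ne'.
by move=> ->; ring.
Qed.

Lemma majorana_anticomm p q :
  majorana R p *m majorana R q + majorana R q *m majorana R p = (2 * (p == q)%:R)%:M.
Proof.
apply/matrixP => y x; rewrite mxE !majorana_mul [RHS]mxE.
have [->|ne] := eqVneq p q.
  by rewrite flipoK jw_coef_sq mulr1; case: eqP; rewrite ?mulr1n ?mulr0n ?addr0 // -mulr2n.
rewrite (flipoC (mode q)) mulr0 mul0rn; case: ifP => _; last by rewrite addr0.
by rewrite jw_coef_anti // addNr.
Qed.

Variables (m : nat) (g : {ffun 'I_m -> bool} -> C).

(** The Boolean treats commuting and anticommuting [Z] together: crossing a monomial produces the
    sign to the power [s] times its degree, and the degree is even. *)
Lemma Himp_twist (s : bool) (Z : 'M[C]_(2 ^ n)) :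
  (forall a : 'I_(2 * n), (a < m)%N ->
     Z *m majorana R a = (-1) ^+ s *: (majorana R a *m Z)) ->
  Z *m Himp n g = Himp n g *m Z.
Proof.
move=> hZ; rewrite /Himp mulmx_sumr mulmx_suml; apply: eq_bigr => x xe.
rewrite -scalemxAr -scalemxAl; congr (_ *: _).
(* For an index outside the range of Majoranas the factor is the zero matrix, and both sides of [FE]
   vanish. *)
pose F (k : 'I_m) := if x k then (if (k < 2 * n)%N =P true is ReflectT Hk
            then majorana R (Ordinal Hk) else 0) else 1%:M : 'M[C]_(2 ^ n).
have FE (k : 'I_m) : Z *m F k = (-1) ^+ (s * x k)%N *: (F k *m Z).
  rewrite /F; case: (x k); rewrite ?muln1 ?muln0 ?expr0 ?scale1r ?mulmx1 ?mul1mx //.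
  case: eqP => Hk; first by rewrite hZ /= ?muln1 // ltn_ord.
  by rewrite mulmx0 mul0mx scaler0.
have PE (r : seq 'I_m) : Z *m (\prod_(k <- r) F k) =
    (-1) ^+ (s * \sum_(k <- r) (x k : nat))%N *: ((\prod_(k <- r) F k) *m Z).
  elim: r => [|k r IH].
    by rewrite !big_nil muln0 expr0 scale1r mulmx1 mul1mx.
  rewrite !big_cons -!mulmxE mulmxA FE -scalemxAl -mulmxA IH -scalemxAr scalerA.
  by rewrite mulnDr exprD mulmxA.
rewrite PE -signr_odd oddM (negPf xe) andbF expr0 scale1r.
by [].
Qed.

End JordanWigner.

(** * Decay of the high-energy part *)

Section Dynamics.
Variable R : realType.
Local Notation C := R[i].
Local Open Scope complex_scope.
Variables (N : nat) (X W Hi U U0 : 'M[C]_N) (d d0 : 'I_N -> R) (m l E0 : R).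
Hypothesis sdX : spectral_decomp X U d.
Hypothesis sd0 : spectral_decomp (X + W) U0 d0.
Hypothesis heisenberg : forall t, exists Wt, prop U d t *m W = Wt *m prop U d t /\
  forall F, `|ip F (Wt *m F)| <= 3 / 4 * m * expR `|t| * ns F.
Hypothesis XHi : X *m Hi = Hi *m X.
Hypothesis Hi_ge : forall v, l * ns v <= ip v (Hi *m v).
Hypothesis shift : E0 - l <= 3 / 2 * m.
Variable psi : 'cV[C]_N.
Hypothesis psiE : (X + W + Hi) *m psi = E0%:C *: psi.

(** The derivative of |phi|^2 is 2 <phi, X phi>. Replacing X by E0 - Hi - W_s bounds it by (3m + 3/2
    m e^s) |phi|^2, using [shift] and the bound on W_s. *)
Lemma ground_state_growth b : 0 <= b ->
  ns (prop U d b *m psi) <= expR (3 * m * b + 3 / 2 * m * (expR b - 1)) * ns psi.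
Proof.
move=> b0; pose phi s := prop U d (1 * s) *m psi.
have D s : vder phi (X *m phi s) s.
  have := @vder_prop _ _ _ _ _ sdX 1 _ _ s (vder_cst psi s).
  by rewrite add0r scale1r mulmxA (prop_comm sdX) // -mulmxA.
have := gronwall (a := 3 * m) (b := 3 / 2 * m) (fun s => vder_ns (D s)) _ b0.
rewrite /phi mul1r mulr0 (prop0 sdX) mul1mx; apply=> s s0.
have [Wt [hW hb]] := heisenberg s.
have XP := prop_comm sdX s (erefl (X *m X)); have HP := prop_comm sdX s XHi.
rewrite mul1r; set f := prop U d s *m psi.
have Xf : X *m f = E0%:C *: f - Hi *m f - Wt *m f.
  have -> : X *m f = prop U d s *m (X *m psi).
    by rewrite /f (mulmxA X) -XP -(mulmxA _ X).
  have -> : X *m psi = E0%:C *: psi - Hi *m psi - W *m psi.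
    by rewrite -psiE !mulmxDl addrK addrK.
  by rewrite /f !mulmxBr -scalemxAr (mulmxA _ Hi) HP (mulmxA _ W) hW -(mulmxA Hi) -(mulmxA Wt).
rewrite Xf !ipDr !ipNr ipZr -/(ns f).
have := hb f; rewrite (ger0_norm s0) ler_norml => /andP [h1 _].
have h2 := Hi_ge f; have h3 : (E0 - l) * ns f <= 3 / 2 * m * ns f by rewrite ler_wpM2r ?ns_ge0.
lra.
Qed.

(** Interaction picture: differentiating e^{-sX} e^{s(X+W)} cancels X and leaves only the conjugated
    coupling, so the growth rate involves neither the bath energy nor [Hi]. *)
Lemma interaction_growth b chi : 0 <= b ->
  ns (prop U d (- b) *m (prop U0 d0 b *m chi)) <= expR (3 / 2 * m * (expR b - 1)) * ns chi.
Proof.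
move=> b0; pose F s := prop U d (-1 * s) *m (prop U0 d0 (1 * s) *m chi).
have D s : vder F (prop U d (-1 * s) *m (W *m (prop U0 d0 (1 * s) *m chi))) s.
  have h0 := @vder_prop _ _ _ _ _ sd0 1 _ _ s (vder_cst chi s).
  have := @vder_prop _ _ _ _ _ sdX (-1) _ _ s h0.
  congr (vder _ _ _); congr (_ *m _).
  rewrite add0r scale1r mulmxA (prop_comm sd0) // -mulmxA mulmxDl.
  by rewrite rmorphN rmorph1 scaleN1r addrC addrA addNr add0r.
have := gronwall (a := 0) (b := 3 / 2 * m) (fun s => vder_ns (D s)) _ b0.
rewrite /F (mul1r b) !mulr0 (prop0 sdX) (prop0 sd0) !mul1mx mul0r add0r mulN1r; apply=> s s0.
have [Wt [hW hb]] := heisenberg (- s).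
rewrite !mulN1r (mulmxA _ W) hW -mulmxA.
have := hb (prop U d (- s) *m (prop U0 d0 (1 * s) *m chi)).
rewrite normrN (ger0_norm s0) ler_norml => /andP [_ h1].
lra.
Qed.

Variables (tau : R) (Q : 'M[C]_N).
Hypothesis low : low_projector (X + W) tau Q.
Local Notation chi := (psi - Q *m psi).

Lemma high_part_decay b : 0 <= b ->
  ns (prop U0 d0 (- b) *m chi) <= expR (- (2 * b * tau)) * ns chi.
Proof.
move=> b0; have [Qh QQ hQ] := low; rewrite /is_hermitian mxadjE in Qh.
rewrite /prop (ns_fmx sd0) ip_fmx (ns_sd sd0) mulr_sumr; apply: ler_sum => k _.
have [dk|dk] := leP (d0 k) tau; last first.
  rewrite ler_wpM2r ?addr_ge0 ?sqr_ge0 // -expRM_natl ler_expR.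
  have : b * tau <= b * d0 k by rewrite ler_wpM2l // ltW.
  lra.
(* An eigenvector with eigenvalue at most [tau] is in the range of [Q], to which [chi] is
   orthogonal. *)
suff -> : (U0 *m chi) k 0 = 0 by rewrite /= expr0n /= addr0 !mulr0.
have [_ hk] := hQ (evec U0 k); case: hk.
  exists 1%N, (fun=> evec U0 k); split; last by rewrite big_ord1.
  by move=> _; exists (d0 k); split=> //; rewrite (evec_eigen sd0).
move=> u Eu.
have : adj (evec U0 k) *m chi = 0.
  by rewrite Eu adjM Qh -mulmxA mulmxBr mulmxA QQ subrr mulmx0.
move/(congr1 (fun B : 'M_1 => B 0 0)); rewrite [RHS]mxE => <-.
rewrite [LHS]mxE [RHS]mxE; apply: eq_bigr => j _; congr (_ * _).
by rewrite !mxE conjcK.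
Qed.

Hypothesis psi1 : ns psi = 1.

Lemma high_part_bound b : 0 <= b ->
  Num.sqrt (ns chi) <= expR (- (b * tau) + 3 / 2 * m * (b + (expR b - 1))).
Proof.
move=> b0; have [Qh QQ hQ] := low; rewrite /is_hermitian mxadjE in Qh.
(* The two propagators cancel, and <chi, Q psi> = 0 turns <chi, psi> into |chi|^2. *)
have E : ns chi = ip (prop U d (- b) *m chi) (prop U d b *m psi).
  rewrite ip_adj adj_prop mulmxA (propNK sdX) mul1mx /ns ipDr ipNr.
  have -> : ip chi (Q *m psi) = 0; last by rewrite subr0.
  by rewrite -{2}Qh -ip_adj mulmxBr mulmxA QQ subrr ip0l.
have h1 := ground_state_growth b0.
(* Starting from the damped vector makes e^{bH0} cancel, so the decay of [h3] can be inserted. *)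
have h2 := interaction_growth (prop U0 d0 (- b) *m chi) b0.
have h3 := high_part_decay b0.
rewrite psi1 mulr1 in h1.
rewrite (mulmxA (prop U0 d0 b)) (propKN sd0) mul1mx in h2.
set r := Num.sqrt (ns chi).
have [r0|rn] := eqVneq r 0; first by rewrite r0 expR_ge0.
have rp : 0 < r by rewrite lt_neqAle eq_sym rn sqrtr_ge0.
have h4 : ns (prop U d (- b) *m chi) <=
    (expR (3 / 4 * m * (expR b - 1) - b * tau) * r) ^+ 2.
  apply: le_trans h2 _; rewrite exprMn sqr_sqrtr ?ns_ge0 // -expRM_natl.
  apply: le_trans (ler_wpM2l (expR_ge0 _) h3) _.
  rewrite mulrA -expRD ler_wpM2r ?ns_ge0 // ler_expR; lra.
have h5 : ns (prop U d b *m psi) <= expR (3 / 2 * m * b + 3 / 4 * m * (expR b - 1)) ^+ 2.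
  by apply: le_trans h1 _; rewrite -expRM_natl ler_expR; lra.
have : r * r <= expR (- (b * tau) + 3 / 2 * m * (b + (expR b - 1))) * r.
  rewrite -expr2 sqr_sqrtr ?ns_ge0 // E; apply: le_trans (cauchy_schwarz _ _) _.
  apply: le_trans (ler_pM (sqrtr_ge0 _) (sqrtr_ge0 _) (ler_wsqrtr h4) (ler_wsqrtr h5)) _.
  rewrite !sqrtr_sqr !ger0_norm ?expR_ge0 ?mulr_ge0 ?expR_ge0 ?sqrtr_ge0 // mulrAC -expRD.
  by rewrite ler_wpM2r ?sqrtr_ge0 // ler_expR; lra.
by rewrite ler_pM2r.
Qed.

End Dynamics.

(** With e^{4b} = tau / (8m) the target exponent is - b tau + tau/4, so it remains to absorb the
    growth term into tau/4 = 2 m e^{4b}. The assumption on [tau] gives ln q >= 1, hence b >= 0. *)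
Lemma tail_exponent (R : realType) (m tau : R) : 0 < m -> 8 * expR 1 * m <= tau ->
  exists2 b : R, 0 <= b &
    expR (- (b * tau) + 3 / 2 * m * (b + (expR b - 1))) <=
      2 * expR (- (tau / 4) * ln (tau / (8 * expR 1 * m))).
Proof.
move=> m0 ht; have e0 : 0 < expR 1 :> R := expR_gt0 1.
have t0 : 0 < tau by apply: lt_le_trans ht; rewrite !mulr_gt0.
pose q := tau / (8 * m); have q0 : 0 < q by rewrite divr_gt0 // mulr_gt0.
have eq : expR 1 <= q by rewrite ler_pdivlMr ?mulr_gt0 // mulrCA mulrA.
pose b := ln q / 4; have lq : 1 <= ln q by rewrite -[1]expRK ler_ln ?posrE.
have b0 : 0 <= b by rewrite divr_ge0 // (le_trans _ lq).
exists b => //.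
have -> : tau / (8 * expR 1 * m) = q / expR 1 by rewrite /q; field; rewrite !gt_eqF.
have -> : ln (q / expR 1) = 4 * b - 1.
  by rewrite ln_div ?posrE // expRK /b; field.
(* The prefactor 2 is given away here. *)
apply: (@le_trans _ _ (expR (- (tau / 4) * (4 * b - 1)))); last first.
  by rewrite ler_peMl ?expR_ge0 // ler1n.
rewrite ler_expR.
have tE : tau = 8 * m * expR b ^+ 4.
  rewrite -expRM_natl /b (_ : 4%:R * (ln q / 4) = ln q); last by field.
  by rewrite lnK ?posrE // /q; field; rewrite gt_eqF.
have h1 := expR_ge1Dx b; set y := expR b in h1 tE *.
(* The difference is 2 (y^2 - 1)^2 + (2y - 3/4)^2 + 7/16. *)
have h2 : 3 * (y - 1) <= 2 * y ^+ 4.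
  have := sqr_ge0 (y ^+ 2 - 1); have := sqr_ge0 (2 * y - 3 / 4); lra.
have h3 : b + (y - 1) <= 2 * (y - 1) by lra.
have h4 : 3 / 2 * m * (b + (y - 1)) <= tau / 4.
  have : m * (b + (y - 1)) <= m * (2 * (y - 1)) by rewrite ler_pM2l.
  have : m * (3 * (y - 1)) <= m * (2 * y ^+ 4) by rewrite ler_pM2l.
  rewrite tE; lra.
lra.
Qed.

(** * The impurity model *)

Section Hamiltonian.
Variable R : realType.
Local Notation C := R[i].
Local Open Scope complex_scope.
Variables (K : nat) (h : 'M[R]_K).

Definition ih : 'M[C]_K := complex.Complex 0 1 *: map_mx (real_complex R) h.

Lemma ihE p q : ih p q = complex.Complex 0 (h p q).
Proof. by rewrite !mxE; apply: complexP => /=; ring. Qed.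

Hypothesis hT : h^T = - h.

Lemma h_antisym p q : h q p = - h p q.
Proof. by have := congr1 (fun B : 'M_K => B p q) hT; rewrite !mxE. Qed.

Lemma ihT : ih^T = - ih.
Proof.
apply/matrixP => p q; rewrite mxE [RHS]mxE !ihE h_antisym.
by apply: complexP; rewrite //= oppr0.
Qed.

Lemma adj_ih : adj ih = ih.
Proof.
by apply/matrixP => p q; rewrite mxE [X in conjc X]mxE !ihE h_antisym /= opprK.
Qed.

(** Since [h] is real, it acts on real and imaginary parts separately, and the factor i only
    exchanges them up to sign. *)
Lemma ih_le : opnorm_le1 h -> forall u : 'cV[C]_K, ns (ih *m u) <= ns u.
Proof.
move=> hop u.
have sq (v : 'cV[R]_K) : rvnorm v ^+ 2 = \sum_i v i 0 ^+ 2.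
  by rewrite sqr_sqrtr // sumr_ge0 // => i _; exact: sqr_ge0.
have le (v : 'cV[R]_K) : \sum_i (h *m v) i 0 ^+ 2 <= \sum_i v i 0 ^+ 2.
  by rewrite -!sq ler_sqr ?nnegrE ?sqrtr_ge0.
pose a : 'cV[R]_K := \col_i complex.Re (u i 0); pose b : 'cV[R]_K := \col_i complex.Im (u i 0).
have -> : ns u = \sum_i a i 0 ^+ 2 + \sum_i b i 0 ^+ 2.
  by rewrite nsE -big_split; apply: eq_bigr => i _; rewrite !mxE.
have -> : ns (ih *m u) = \sum_i (h *m a) i 0 ^+ 2 + \sum_i (h *m b) i 0 ^+ 2.
  rewrite nsE addrC -big_split; apply: eq_bigr => i _ /=.
  rewrite mxE Re_sum Im_sum; congr (_ + _).
    rewrite -sqrrN -sumrN; congr (_ ^+ 2); rewrite [RHS]mxE; apply: eq_bigr => j _.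
    by rewrite ihE ReM /= mul0r sub0r opprK mxE.
  congr (_ ^+ 2); rewrite [RHS]mxE; apply: eq_bigr => j _.
  by rewrite ihE ImM /= mul0r add0r mxE.
by rewrite lerD.
Qed.

(* tr S = sum_k <u_k, S u_k> <= sum_k |S u_k| = sum_k |M u_k| over an eigenbasis
   of M = ih, since S^2 = h^T h = M^2. *)
Lemma trace_norm_le t1 V (e : 'I_K -> R) :
  trace_norm_is h t1 -> spectral_decomp ih V e -> t1 <= \sum_k `|e k|.
Proof.
move=> [S [[ST _] SS tE]] sd; pose Sc := map_mx (real_complex R) S.
have -> : t1 = \sum_k ip (evec V k) (Sc *m evec V k).
  have -> : t1 = complex.Re (\tr Sc) by rewrite /Sc trace_map_mx -tE.
  have -> : \tr Sc = \tr (V *m Sc *m adj V).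
    by rewrite mxtrace_mulC mulmxA (sd_l sd) mul1mx.
  rewrite Re_sum; apply: eq_bigr => k _; congr complex.Re.
  rewrite -mulmxA !mxE; apply: eq_bigr => i _; congr (_ * _); first by rewrite !mxE conjcK.
  by rewrite !mxE; apply: eq_bigr => j _; rewrite !mxE.
apply: ler_sum => k _; apply: le_trans (cauchy_schwarz _ _) _.
rewrite (ns_evec sd) sqrtr1 mul1r.
have adjS : adj Sc = Sc.
  apply/matrixP => i j; rewrite !mxE conj_real.
  by have := congr1 (fun B : 'M_K => B i j) ST; rewrite !mxE => ->.
have SM : Sc *m Sc = ih *m ih.
  rewrite /Sc -map_mxM SS hT mulNmx /ih -scalemxAl -scalemxAr scalerA -map_mxM map_mxN.
  rewrite (_ : _ * _ = -1 :> C) ?scaleN1r //.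
  by apply: complexP => /=; ring.
have -> : ns (Sc *m evec V k) = ns (ih *m evec V k).
  by rewrite /ns !ip_adj adjS adj_ih !mulmxA SM.
by rewrite (evec_eigen sd) nsZ (ns_evec sd) mulr1 sqrtr_sqr.
Qed.

End Hamiltonian.

(** * Assembly for the impurity Hamiltonian *)

Section Impurity.
Variable R : realType.
Local Notation C := R[i].
Local Open Scope complex_scope.

Lemma H0E n (h : 'M[R]_(2 * n)) t1 : H0 h t1 = H0m (@majorana R n) (ih h) t1.
Proof.
rewrite /H0 /H0m /quad; congr (_ + _); rewrite !scaler_sumr; apply: eq_bigr => p _.
rewrite !scaler_sumr; apply: eq_bigr => q _; rewrite !scalerA; congr (_ *: _).
have -> : (4^-1 : R)%:C = 4^-1 by rewrite fmorphV rmorph_nat.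
by rewrite !mxE mulrAC mulrC.
Qed.

Lemma ground_state_variational N (H : 'M[C]_N) psi : adj H = H -> ground_state H psi ->
  exists E : R, H *m psi = E%:C *: psi /\ forall v, E * ns v <= ip v (H *m v).
Proof.
move=> hH [psi1 [E [HE Emin]]]; have [U [d sd]] := hermitian_spectral hH.
have psi0 : psi != 0.
  apply/eqP => p0; move/eqP: psi1; rewrite vnormE p0 /ns ip0r sqrtr0 eq_sym.
  by rewrite oner_eq0.
have Ed k : E <= (d k)%:C by apply: Emin (evec_neq0 sd k) (evec_eigen sd k).
have [k _] : exists k, psi k 0 != 0.
  apply/existsP; apply: contraNT psi0; rewrite negb_exists => /forallP h.
  by apply/eqP/matrixP => i j; rewrite ord1 mxE; apply/eqP; rewrite -[_ == _]negbK.
(* In the order on complex numbers, being below a real number forces the imaginary part to be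
   zero. *)
have ER : E = (complex.Re E)%:C.
  by have := Ed k; rewrite lecE => /andP [/eqP i0 _]; apply: complexP.
exists (complex.Re E); rewrite -ER; split=> // v; apply: (ip_sd_ge sd) => j.
by have := Ed j; rewrite lecE => /andP [].
Qed.

(** The evolution time [b] is still free here; its choice is a purely real optimization. *)
Lemma impurity_tail n m (h : 'M[R]_(2 * n)) t1 (g : {ffun 'I_m -> bool} -> C)
    tau (Q : 'M[C]_(2 ^ n)) (psi : 'cV[C]_(2 ^ n)) (b : R) :
  h^T = - h -> opnorm_le1 h -> trace_norm_is h t1 -> (m <= 2 * n)%N ->
  is_hermitian (Himp n g) -> ground_state (H0 h t1 + Himp n g) psi ->
  low_projector (H0 h t1) tau Q -> 0 <= b ->
  vnorm (psi - Q *m psi) <= expR (- (b * tau) + 3 / 2 * m%:R * (b + (expR b - 1))).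
Proof.
move=> hT hop htr mn; rewrite /is_hermitian mxadjE => Hih gs low b0.
have cH := @adj_majorana R n; have cC := @majorana_anticomm R n.
have MT := ihT hT; have Mh := adj_ih hT; have Mle := ih_le hop.
have [V [e sdM]] := hermitian_spectral Mh.
have t1le := trace_norm_le hT htr sdM.
pose A : pred 'I_(2 * n) := fun p => (p < m)%N.
have mE : \sum_(a | A a) 1 = m%:R :> R.
  rewrite -[RHS](_ : \sum_(i < m) 1 = _); last by rewrite sumr_const card_ord.
  by rewrite (big_ord_widen (2 * n) (fun=> 1 : R) mn).
rewrite H0E (H0mE _ _ A) in gs low *.
have hH : adj (Xm (@majorana R n) (ih h) A t1 + Wm (@majorana R n) (ih h) A + Himp n g) =
   Xm (@majorana R n) (ih h) A t1 + Wm (@majorana R n) (ih h) A + Himp n g.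
  by rewrite adjD -H0mE (adj_H0m cH t1 Mh) Hih.
have [psi1 _] := gs.
have nspsi : ns psi = 1 by rewrite -(sqr_sqrtr (ns_ge0 psi)) -vnormE psi1 expr1n.
have psi0 : psi != 0 by rewrite -ns_gt0 nspsi.
have [E0 [HE Evar]] := ground_state_variational hH gs.
have [U [d sdX]] := hermitian_spectral (adj_Xm cH A t1 Mh).
have h0 : adj (Xm (@majorana R n) (ih h) A t1 + Wm (@majorana R n) (ih h) A) =
   Xm (@majorana R n) (ih h) A t1 + Wm (@majorana R n) (ih h) A.
  by rewrite -H0mE (adj_H0m cH t1 Mh).
have [U0 [d0 sd0]] := hermitian_spectral h0.
have Hc Z : (forall a, A a -> Z *m majorana R a = majorana R a *m Z) ->
    Z *m Himp n g = Himp n g *m Z.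
  by move=> hZ; apply: (@Himp_twist _ _ _ _ false) => a Aa; rewrite expr0 scale1r hZ.
have Ha Z : (forall a, A a -> Z *m majorana R a = - (majorana R a *m Z)) ->
    Z *m Himp n g = Himp n g *m Z.
  by move=> hZ; apply: (@Himp_twist _ _ _ _ true) => a Aa; rewrite expr1 scaleN1r hZ.
have heis := heisenberg_W cH cC MT Mh Mle sdX.
have comm := Xm_comm_Hi cC t1 MT Hc.
rewrite -(H0mE _ _ A) in Evar.
have [l [hl shift]] := ground_energy_shift cH cC MT Mh Mle sdX Hih Ha sdM t1le psi0 Evar.
rewrite mE in shift heis.
rewrite vnormE.
exact: (high_part_bound sdX sd0 heis comm hl shift HE low nspsi b0).
Qed.

End Impurity.

Theorem theorem3 (R : realType) (n m : nat)
    (h : 'M[R]_(2 * n)) (t1 : R)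
    (g : {ffun 'I_m -> bool} -> R[i])
    (tau : R) (Q : 'M[R[i]]_(2 ^ n)) (psi : 'cV[R[i]]_(2 ^ n)) :
  trmx h = - h ->
  opnorm_le1 h ->
  trace_norm_is h t1 ->
  (0 < m)%N -> (m <= 2 * n)%N ->
  is_hermitian (Himp n g) ->
  ground_state (H0 h t1 + Himp n g) psi ->
  low_projector (H0 h t1) tau Q ->
  8 * expR 1 * m%:R <= tau ->
  vnorm (psi - Q *m psi)
    <= 2 * expR (- (tau / 4) * ln (tau / (8 * expR 1 * m%:R))).
Proof.
move=> hT hop htr m0 mn Hih gs low ht.
have m0' : 0 < m%:R :> R by rewrite ltr0n.
have [b b0 hb] := tail_exponent m0' ht.
exact: le_trans (impurity_tail hT hop htr mn Hih gs low b0) hb.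
Qed.
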